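(* Let $n\geq 1$. For any nonempty pattern $\tau$ (i.e. any permutation $\tau$ of length at least $1$), $$|\mathcal{AI}_n(123\oplus\tau)|=|\mathcal{AI}_n(321\oplus\tau)|.$$
   Context: Permutations of $[n]=\{1,\ldots,n\}$ are written in one-line notation $\pi=\pi_1\pi_2\cdots\pi_n$. A permutation is alternating if $\pi_1<\pi_2>\pi_3<\pi_4>\cdots$, and is an involution if $\pi=\pi^{-1}$. A permutation $\pi$ contains a permutation (pattern) $\sigma$ if some subsequence of $\pi$ is order isomorphic to $\sigma$; otherwise $\pi$ avoids $\sigma$. $\mathcal{AI}_n(\sigma)$ denotes the set of alternating involutions of $[n]$ that avoid $\sigma$. The direct sum of $\pi=\pi_1\cdots\pi_k\in\mathcal{S}_k$ and $\tau=\tau_1\cdots\tau_m\in\mathcal{S}_m$ is the permutation $\pi\oplus\tau=\pi_1\cdots\pi_k(\tau_1+k)(\tau_2+k)\cdots(\tau_m+k)$. *)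

(* Defs.v *)
From mathcomp Require Import all_boot all_fingroup.

Set Implicit Arguments.
Unset Strict Implicit.
Unset Printing Implicit Defensive.

(* Permutations of [n] are elements of 'S_n, with positions and values shifted
   down by one: the letter pi_(i+1) of the one-line notation is (pi i).+1. *)

(* pi_1 < pi_2 > pi_3 < ...: the 0-based position i starts an ascent when it is
   even, a descent when it is odd. *)
Definition alternating n (pi : 'S_n) : bool :=
  [forall i : 'I_n, forall j : 'I_n, (j == i.+1 :> nat) ==>
     (if odd i then pi j < pi i else pi i < pi j)].

Definition contains n k (pi : 'S_n) (sigma : 'S_k) : bool :=
  [exists f : {ffun 'I_k -> 'I_n},
     [forall i : 'I_k, forall j : 'I_k, (i < j) ==> (f i < f j)] &&
     [forall i : 'I_k, forall j : 'I_k, (pi (f i) < pi (f j)) == (sigma i < sigma j)]].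

Definition avoids n k (pi : 'S_n) (sigma : 'S_k) : bool := ~~ contains pi sigma.

Definition AI n k (sigma : 'S_k) : {set 'S_n} :=
  [set pi : 'S_n | [&& alternating pi, pi == (pi^-1)%g & avoids pi sigma]].

Definition dsum_fun k m (pi : 'S_k) (tau : 'S_m) (x : 'I_(k + m)) : 'I_(k + m) :=
  match split x with
  | inl i => lshift m (pi i)
  | inr j => rshift k (tau j)
  end.

Lemma dsum_fun_inj k m (pi : 'S_k) (tau : 'S_m) : injective (dsum_fun pi tau).
Proof.
move=> x y; rewrite /dsum_fun.
case: (split_ordP x) => i ->; case: (split_ordP y) => j -> /eqP;
  rewrite eq_shift // => /eqP; first by move/perm_inj ->.
by move/perm_inj ->.
Qed.

Definition dsum k m (pi : 'S_k) (tau : 'S_m) : 'S_(k + m) :=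
  perm (@dsum_fun_inj k m pi tau).

Definition p123 : 'S_3 := 1%g.
Definition p321 : 'S_3 := perm (@rev_ord_inj 3).

(* Main.v *)
Require Import Defs.
From mathcomp Require Import all_boot all_fingroup.
From mathcomp Require Import zify.

(* A cell (position, value) of an involution pi is dominated when a copy of tau or of tau^-1
   lies strictly above and to the right of it. The dominated cells form a symmetric Ferrers
   shape, which does not change when the points of pi inside it are rearranged, and pi avoids
   123 + tau (321 + tau) iff there is no 123 (321) whose bounding box lies in the shape. So
   it is enough to compare the involutive rearrangements for a given shape and given points
   outside it. If pi is alternating then the dominated columns form runs of equal height that
   begin and end at a valley, and a rearrangement is alternating iff it keeps the peaks at the
   same dominated positions.

   Fomin's growth diagrams identify the rearrangements avoiding 321, resp. 123, with labelings
   of the border of the shape by partitions with at most two rows, resp. columns. A peak at x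
   is a descent at x in the former case and an ascent at x - 1 in the latter, because the
   other comparison is forced by the avoidance; both mean that consecutive border steps add a
   box to the first and then to the second row (column). Knuth moves on the border labels
   shift these step pairs by one column, which turns one condition into the other. *)

Set Implicit Arguments.
Unset Strict Implicit.
Unset Printing Implicit Defensive.

(** * Local growth rules *)

(* The label (a, b) stands for the partition with rows a, b in [row_rule], and for the one
   with columns a, b in [col_rule]. *)
Definition label := (nat * nat)%type.
Definition valid (u : label) := u.2 <= u.1.
Definition size2 (u : label) := u.1 + u.2.
Definition step (c : bool) (u v : label) :=
  if c then (v == (u.1.+1, u.2)) || (v == (u.1, u.2.+1)) else v == u.

(* Labels of the corners of a cell: r lower left, m upper left, u lower right, l upper right;
   c tells whether the cell contains a point. *)
Definition local_rel (fwd : label -> label -> label -> bool -> label)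
    (bwd : label -> label -> label -> label) (r m u l : label) (c : bool) :=
  [&& r == bwd m u l, l == fwd r m u c &
      size2 l + size2 r == size2 m + size2 u + c].

(** What the correspondence between placements and border labels needs from a rule: symmetry, so
    that involutions give symmetric diagrams, and propagation of single-box steps in both
    directions. The flags [a], [b] record a point below in the same column, resp. to the left in the
    same row. *)
Record growth_rule := GrowthRule {
  fwd : label -> label -> label -> bool -> label;
  bwd : label -> label -> label -> label;
  fwdC : forall r m u c, fwd r m u c = fwd r u m c;
  bwdC : forall m u l, bwd m u l = bwd u m l;
  local_fwd : forall r m u l a b c,
    valid r -> valid m -> valid u -> step a r u -> step b r m ->
    c ==> ~~ a && ~~ b -> local_rel fwd bwd r m u l c ->
    [/\ valid l, step (a || c) m l & step (b || c) u l];
  local_bwd : forall m u l a b,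
    valid m -> valid u -> valid l -> step a m l -> step b u l ->
    exists a' b' c, [/\ valid (bwd m u l), step a' (bwd m u l) u,
      step b' (bwd m u l) m & local_rel fwd bwd (bwd m u l) m u l c]
}.

(* Fomin's rules, which are those of the Robinson-Schensted correspondence. They are only
   meant for cells on which the third row, resp. column, stays empty; [local_rel] excludes
   the other cells, where the functions return junk. *)
Definition row_fwd (r m u : label) (c : bool) : label :=
  let a := if c then r.1.+1 else maxn m.1 u.1 in
  (a, size2 m + size2 u + c - size2 r - a).

Definition row_bwd (m u l : label) : label :=
  if m == l then u else if u == l then m
  else if (m == u) && (m.1 < l.1) then m else (l.1.-1, l.2.-1).

(** The same rule read on column lengths. When [m = u] differs from [r], the added box is bumped to
    the end of the next row, which lies in the second column only if that row already has one
    box. *)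
Definition col_fwd (r m u : label) (c : bool) : label :=
  if c then (if r.1 == 0 then (1, 0) else (r.1, 1))
  else if m == r then u else if u == r then m
  else if m != u then (maxn m.1 u.1, maxn m.2 u.2)
  else if (r.2 < m.2) && (m.2 < m.1) then (m.1, m.2.+1) else (m.1.+1, m.2).

Definition col_bwd (m u l : label) : label :=
  if m == l then u else if u == l then m
  else if m != u then (l.1.-1, l.2.-1)
  else if m.2 < l.2 then (if l.2 == 1 then m else (m.1, m.2.-1))
  else if l.1 == 1 then m
  else if m.2 == m.1 then (m.1, m.2.-1) else (m.1.-1, m.2).

Lemma row_fwdC r m u c : row_fwd r m u c = row_fwd r u m c.
Proof. by rewrite /row_fwd maxnC (addnC (size2 m)). Qed.

Lemma row_bwdC m u l : row_bwd m u l = row_bwd u m l.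
Proof.
by rewrite /row_bwd (eq_sym m u); do !case: eqP => //= *; subst=> //; case: ifP.
Qed.

Lemma col_fwdC r m u c : col_fwd r m u c = col_fwd r u m c.
Proof.
rewrite /col_fwd (eq_sym m u) maxnC (maxnC m.2).
by do !case: eqP => //= *; subst=> //; case: ifP.
Qed.

Lemma col_bwdC m u l : col_bwd m u l = col_bwd u m l.
Proof.
by rewrite /col_bwd (eq_sym m u); do !case: eqP => //= *; subst=> //; case: ifP.
Qed.

Ltac case_ifs :=
  rewrite ?xpair_eqE /=;
  repeat match goal with
    | |- context [if ?b then _ else _] =>
      let B := fresh "B" in case: (boolP b) => B; rewrite ?xpair_eqE /=;
      try (exfalso; lia)
    end.

Ltac unfold_rules :=
  rewrite /local_rel /valid /size2 /row_fwd /row_bwd /col_fwd /col_bwd /step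
    /size2 /=.

Lemma row_local_fwd r m u l a b c :
    valid r -> valid m -> valid u -> step a r u -> step b r m ->
    c ==> ~~ a && ~~ b -> local_rel row_fwd row_bwd r m u l c ->
    [/\ valid l, step (a || c) m l & step (b || c) u l].
Proof.
case: r m u l => [r1 r2] [m1 m2] [u1 u2] [l1 l2].
case: a; case: b; case: c => //; unfold_rules; move=> vr vm vu;
  repeat (first [case/orP | move/eqP => [? ?]; subst]); move=> _ /and3P[R1 L1 S];
  move: R1 L1; case_ifs; move=> R1 L1; split; lia.
Qed.

Lemma col_local_fwd r m u l a b c :
    valid r -> valid m -> valid u -> step a r u -> step b r m ->
    c ==> ~~ a && ~~ b -> local_rel col_fwd col_bwd r m u l c ->
    [/\ valid l, step (a || c) m l & step (b || c) u l].
Proof.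
case: r m u l => [r1 r2] [m1 m2] [u1 u2] [l1 l2].
case: a; case: b; case: c => //; unfold_rules; move=> vr vm vu;
  repeat (first [case/orP | move/eqP => [? ?]; subst]); move=> _ /and3P[R1 L1 S];
  move: R1 L1; case_ifs; move=> R1 L1; split; lia.
Qed.

Lemma row_local_bwd m u l a b :
    valid m -> valid u -> valid l -> step a m l -> step b u l ->
    exists a' b' c, [/\ valid (row_bwd m u l), step a' (row_bwd m u l) u,
      step b' (row_bwd m u l) m & local_rel row_fwd row_bwd (row_bwd m u l) m u l c].
Proof.
(* The cell contains a point exactly when the box of [l] beyond [m = u] is in the first row; any
   other box was bumped from the row above. *)
pose c := [&& m != l, m == u & m.1 < l.1].
move=> vm vu vl sm su; exists (a && ~~ c), (b && ~~ c), c; rewrite {}/c.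
move: m u l vm vu vl sm su => [m1 m2] [u1 u2] [l1 l2].
case: a; case: b => //; unfold_rules; move=> vm vu vl;
  repeat (first [case/orP | move/eqP => [? ?]; subst]);
  case_ifs; split; rewrite ?xpair_eqE /=; case_ifs; lia.
Qed.

Lemma col_local_bwd m u l a b :
    valid m -> valid u -> valid l -> step a m l -> step b u l ->
    exists a' b' c, [/\ valid (col_bwd m u l), step a' (col_bwd m u l) u,
      step b' (col_bwd m u l) m & local_rel col_fwd col_bwd (col_bwd m u l) m u l c].
Proof.
(* Again the new box lies in the first row: it is the first box of its column. *)
pose c := [&& m != l, m == u & (if m.2 < l.2 then l.2 == 1 else l.1 == 1)].
move=> vm vu vl sm su; exists (a && ~~ c), (b && ~~ c), c; rewrite {}/c.
move: m u l vm vu vl sm su => [m1 m2] [u1 u2] [l1 l2].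
case: a; case: b => //; unfold_rules; move=> vm vu vl;
  repeat (first [case/orP | move/eqP => [? ?]; subst]);
  case_ifs; split; rewrite ?xpair_eqE /=; case_ifs; lia.
Qed.

Definition row_rule := GrowthRule row_fwdC row_bwdC row_local_fwd row_local_bwd.
Definition col_rule := GrowthRule col_fwdC col_bwdC col_local_fwd col_local_bwd.

(** * Growth diagrams on a symmetric shape *)

Record sym_shape (n : nat) := SymShape {
  cell :> nat -> nat -> bool;
  cell_le : forall x y x' y', x' <= x -> y' <= y -> cell x y -> cell x' y';
  cellC : forall x y, cell x y = cell y x;
  cell_lt : forall x y, cell x y -> x < n
}.

Section Growth.

Variables (n : nat) (la : sym_shape n).

(* A vertex (x, y) is the lower left corner of the cell (x, y); the region consists of the
   axes and of the upper right corners of the cells. *)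
Definition vertex x y := [|| x == 0, y == 0 | la x.-1 y.-1].

Definition border x y := vertex x y && ~~ la x y.

Lemma vertex_le x y x' y' : x' <= x -> y' <= y -> vertex x y -> vertex x' y'.
Proof.
move=> lex ley /or3P[/eqP xy0|/eqP xy0|lxy]; rewrite /vertex.
- by move: lex; rewrite xy0 leqn0 => ->.
- by move: ley; rewrite xy0 leqn0 => ->; rewrite orbT.
- by rewrite (@cell_le _ _ x.-1 y.-1) ?orbT //; lia.
Qed.

Lemma vertexC x y : vertex x y = vertex y x.
Proof. by rewrite /vertex cellC orbCA. Qed.

Lemma cell_vertex x y : la x y -> vertex x y.
Proof. by move=> l; apply: (@vertex_le x.+1 y.+1). Qed.

Fixpoint growth (G : growth_rule) (p : nat -> nat) (x y : nat) {struct x} : label :=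
  if x is x'.+1 then
    (fix up y := if y is y'.+1 then
       fwd G (growth G p x' y') (growth G p x' y) (up y') (p x' == y')
     else (0, 0)) y
  else (0, 0).

Definition local_rule (G : growth_rule) (l : nat -> nat -> label) x y c :=
  local_rel (fwd G) (bwd G) (l x y) (l x y.+1) (l x.+1 y) (l x.+1 y.+1) c.

(** [growth] is total, even where a third row or column would be required. This condition says that
    no such cell occurs in the shape, so that every cell can be reversed. *)
Definition growth_ok (G : growth_rule) (p : nat -> nat) :=
  forall x y, la x y -> local_rule G (growth G p) x y (p x == y).

Variable p0 : nat -> nat.
Hypothesis p0K : involutive p0.

Definition inside x := la x (p0 x).

Definition placement (p : nat -> nat) :=
  [/\ involutive p, forall x, la x (p x) = inside x
    & forall x, ~~ inside x -> p x = p0 x].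

(** * From placements to border labels *)

Section Forward.

Variables (G : growth_rule) (p : nat -> nat).
Hypothesis pK : involutive p.

Lemma inv_eqC x y : (p x == y) = (p y == x).
Proof. by apply/eqP/eqP=> <-. Qed.

Lemma growth_x0 x : growth G p x 0 = (0, 0).
Proof. by case: x. Qed.

Lemma growthC x y : growth G p x y = growth G p y x.
Proof.
have [m] := ubnP (x + y); elim: m x y => // m IH [|x] [|y] //= lem.
rewrite [LHS]/= -/(growth G p x.+1 y) -/(growth G p y.+1 x).
rewrite fwdC inv_eqC; congr fwd; apply: IH; lia.
Qed.

Hypothesis okp : growth_ok G p.

(** Validity and horizontal steps need a joint induction, since [local_fwd] uses both at the other
    corners; the vertical step is the horizontal one at the mirrored vertex. *)
Lemma growth_step_valid x y : vertex x y ->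
  valid (growth G p x y) /\ (0 < x -> step (p x.-1 < y) (growth G p x.-1 y) (growth G p x y)).
Proof.
have [m] := ubnP (x + y); elim: m x y => // m IH [|x] [|y] lem vxy;
  try by split; rewrite // growth_x0.
have lxy : la x y by [].
have vyx : vertex y.+1 x by rewrite vertexC; exact: vertex_le vxy.
have [v1 /(_ isT) s1] := IH x.+1 y ltac:(lia) (vertex_le (leqnn _) (leqnSn _) vxy).
have [v2 /(_ isT)] := IH y.+1 x ltac:(lia) vyx.
have [v3 _] := IH x y ltac:(lia) (vertex_le (leqnSn _) (leqnSn _) vxy).
rewrite growthC in v2; rewrite (growthC y.+1.-1 x) (growthC y.+1 x) => s2.
have nc : (p x == y) ==> ~~ (p x < y) && ~~ (p y < x).
  by apply/implyP=> /eqP <-; rewrite pK !ltnn.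
have [vl sl _] := local_fwd v3 v2 v1 s1 s2 nc (okp lxy).
by split=> // _; rewrite ltnS leq_eqVlt orbC.
Qed.

Lemma growth_valid x y : vertex x y -> valid (growth G p x y).
Proof. by case/growth_step_valid. Qed.

Lemma growth_step x y : vertex x.+1 y ->
  step (p x < y) (growth G p x y) (growth G p x.+1 y).
Proof. by case/growth_step_valid=> _; apply. Qed.

End Forward.

(** The labelings of the border that arise from placements. Only horizontal edges are constrained,
    since symmetry takes care of the vertical ones. The definition is independent of the growth
    rule. *)
Definition walk (w : nat -> nat -> label) :=
  [/\ forall x y, border x y -> w x y = w y x,
      forall x y, border x y -> valid (w x y),
      forall x, border x 0 -> w x 0 = (0, 0)
    & forall x y, border x y -> border x.+1 y ->
        step (inside x) (w x y) (w x.+1 y)].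

Lemma growth_walk G p : placement p -> growth_ok G p -> walk (growth G p).
Proof.
move=> [pK pin pout] okp; split.
- by move=> x y _; apply: growthC.
- by move=> x y /andP[? _]; apply: growth_valid.
- by move=> x _; apply: growth_x0.
move=> x y /andP[vxy nxy] /andP[vxy' _].
(* At a border edge, the cells of column [x] below [y] are exactly those of the shape. *)
have <- : (p x < y) = inside x; last exact: growth_step.
rewrite -pin; apply/idP/idP => [lt|l].
  by case: y lt vxy' {vxy nxy} => // y lt; apply: cell_le.
by rewrite ltnNge; apply: contra nxy => le; apply: cell_le l.
Qed.

Definition border_eq (w w' : nat -> nat -> label) :=
  forall x y, border x y -> w x y = w' x y.

Lemma local_rule_inj G l l' x y c c' :
    local_rule G l x y c -> local_rule G l' x y c' ->
    l x y.+1 = l' x y.+1 -> l x.+1 y = l' x.+1 y -> l x.+1 y.+1 = l' x.+1 y.+1 ->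
  l x y = l' x y /\ c = c'.
Proof.
move=> /and3P[/eqP r1 _ /eqP s1] /and3P[/eqP r2 _ /eqP s2] e1 e2 e3.
have e : l x y = l' x y by rewrite r1 r2 e1 e2 e3.
split=> //; move: s1 s2; rewrite e e1 e2 e3 => ->.
by move/eqP; rewrite eqn_add2l; case: c c' => [] [].
Qed.

(** Each cell determines its lower left label and its content from the three other labels, so the
    border determines all labels by induction towards the origin, and hence the points. *)
Lemma growth_inj G p p' : placement p -> placement p' ->
    growth_ok G p -> growth_ok G p' ->
  border_eq (growth G p) (growth G p') -> p =1 p'.
Proof.
move=> [pK pin pout] [pK' pin' pout'] ok ok' e.
have E x y : vertex x y -> growth G p x y = growth G p' x y.
  have [m] := ubnP (n - x + (n - y)); elim: m x y => // m IH x y lem vxy.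
  have [lxy|nlxy] := boolP (la x y); last by apply: e; rewrite /border vxy.
  have ltx := cell_lt lxy; have lty : y < n by move: lxy; rewrite cellC => /cell_lt.
  have IH' i j : i <= 1 -> j <= 1 -> 0 < i + j ->
      growth G p (i + x) (j + y) = growth G p' (i + x) (j + y).
    move=> lei lej lt; apply: IH; first lia.
    by apply: (@vertex_le x.+1 y.+1) => //; lia.
  have [E1 _] := local_rule_inj (ok _ _ lxy) (ok' _ _ lxy)
    (IH' 0 1 isT isT isT) (IH' 1 0 isT isT isT) (IH' 1 1 isT isT isT).
  exact: E1.
move=> x; have [ix|nix] := boolP (inside x); last by rewrite pout ?pout'.
have lx : la x (p x) by rewrite pin.
have V i j : i <= x.+1 -> j <= (p x).+1 -> vertex i j.
  by move=> *; apply: (@vertex_le x.+1 (p x).+1).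
have [_] := local_rule_inj (ok _ _ lx) (ok' _ _ lx)
  (E _ _ (V _ _ (leqnSn _) (leqnn _))) (E _ _ (V _ _ (leqnn _) (leqnSn _)))
  (E _ _ (V _ _ (leqnn _) (leqnn _))).
by rewrite eqxx => /esym/eqP.
Qed.

Lemma not_cell_ex x : exists y, ~~ la x y.
Proof. by exists n; apply/negP; rewrite cellC => /cell_lt; rewrite ltnn. Qed.

Definition height x := ex_minn (not_cell_ex x).

Lemma heightP x y : la x y = (y < height x).
Proof.
rewrite /height; case: ex_minnP => h nh mh; rewrite ltnNge.
apply/idP/negP => [l leh|nle]; first by move: nh; rewrite (cell_le _ leh l).
by apply/negP => nl; apply/nle/mh/negP.
Qed.

Lemma border_height x : border x (height x).
Proof.
rewrite /border heightP ltnn andbT /vertex.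
case E : (height x) => [|h] /=; first by rewrite orbT.
by rewrite (@cell_le _ _ x h) ?orbT ?leq_pred // heightP E.
Qed.

Lemma border_height1 x : border x.+1 (height x).
Proof.
rewrite /border; apply/andP; split; last first.
  by have: ~~ la x (height x); [rewrite heightP ltnn | apply: contra; apply: cell_le].
rewrite /vertex; case E : (height x) => [|h] //=.
by rewrite heightP E.
Qed.

(* Recovers all labels from those on the border w, cell by cell towards the origin. *)
Fixpoint shrink_rec G (w : nat -> nat -> label) k x y : label :=
  if k is k'.+1 then
    if la x y then bwd G (shrink_rec G w k' x y.+1) (shrink_rec G w k' x.+1 y)
                         (shrink_rec G w k' x.+1 y.+1)
    else w x y
  else w x y.

Definition shrink G w x y := shrink_rec G w (n - x + (n - y)) x y.

Lemma cell_bound x y : la x y -> x < n /\ y < n.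
Proof. by move=> l; split; [exact: cell_lt l | move: l; rewrite cellC => /cell_lt]. Qed.

Lemma shrink_rec_fuel G w k k' x y :
    n - x + (n - y) <= k -> n - x + (n - y) <= k' ->
  shrink_rec G w k x y = shrink_rec G w k' x y.
Proof.
elim: k k' x y => [|k IH] [|k'] x y //= lek lek'; have [l|//] := boolP (la x y);
  have [ltx lty] := cell_bound l; first [lia | congr bwd; apply: IH; lia].
Qed.

Lemma shrink_in G w x y : la x y ->
  shrink G w x y = bwd G (shrink G w x y.+1) (shrink G w x.+1 y) (shrink G w x.+1 y.+1).
Proof.
move=> l; have [ltx lty] := cell_bound l.
rewrite [LHS](@shrink_rec_fuel _ _ _ (n - x + (n - y)).-1.+1) /= ?l; try lia.
by congr bwd; apply: shrink_rec_fuel; lia.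
Qed.

Lemma shrink_out G w x y : ~~ la x y -> shrink G w x y = w x y.
Proof. by rewrite /shrink; case: (_ + _) => //= k /negPf->. Qed.

(** * From border labels back to placements *)

Section Backward.

Variables (G : growth_rule) (w : nat -> nat -> label).
Hypothesis walk_w : walk w.

Let H := shrink G w.

(** The four claims are proved together: [local_bwd] at a cell needs validity and steps along its
    top and right sides, and the step on the right side comes from the mirrored cell by symmetry. *)
Lemma shrink_inv x y : vertex x y ->
  [/\ valid (H x y), H x y = H y x,
      vertex x.+1 y -> exists a, step a (H x y) (H x.+1 y)
    & la x y -> exists c, local_rule G H x y c].
Proof.
have [m] := ubnP (n - x + (n - y)); elim: m x y => // m IH x y lem vxy.
have [wC wv _ ws] := walk_w.
have [lxy|nlxy] := boolP (la x y); last first.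
  have bxy : border x y by rewrite /border vxy.
  have nlyx : ~~ la y x by rewrite cellC.
  have Hw : H x y = w x y by exact: shrink_out.
  rewrite Hw; split=> //; first exact: wv.
    by rewrite wC //; apply/esym/shrink_out.
  move=> vx1y; exists (inside x).
  have nl' : ~~ la x.+1 y by apply: contra nlxy; apply: cell_le.
  have -> : H x.+1 y = w x.+1 y by exact: shrink_out.
  by apply: ws => //; rewrite /border vx1y.
have [ltx lty] := cell_bound lxy.
have [m01 m10 m11 m10'] : [/\ n - x + (n - y.+1) < m, n - x.+1 + (n - y) < m,
    n - x.+1 + (n - y.+1) < m & n - y + (n - x.+1) < m] by split; lia.
have v11 : vertex x.+1 y.+1 by [].
have v01 : vertex x y.+1 by apply: vertex_le v11.
have v10 : vertex x.+1 y by apply: vertex_le v11.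
have [val1 e1 /(_ v11) [a sa] _] := IH x y.+1 m01 v01.
have [val2 e2 _ _] := IH x.+1 y m10 v10.
have [val3 e3 _ _] := IH x.+1 y.+1 m11 v11.
have v10' : vertex y x.+1 by rewrite vertexC.
have v11' : vertex y.+1 x.+1 by rewrite vertexC.
have [_ _ /(_ v11') [b sb] _] := IH y x.+1 m10' v10'.
rewrite -e2 -e3 in sb.
have Hr : H x y = bwd G (H x y.+1) (H x.+1 y) (H x.+1 y.+1) by exact: shrink_in.
have [a' [b' [c [vr su sm lr]]]] := local_bwd G val1 val2 val3 sa sb.
rewrite -Hr in vr su sm lr; split=> //.
- by rewrite Hr bwdC e1 e2 e3; apply/esym/shrink_in; rewrite cellC.
- by exists a'.
- by exists c.
Qed.

(** The points are recovered from the sizes alone, as the cells where the size identity has an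
    excess of one. *)
Definition fill x y :=
  la x y && (size2 (H x.+1 y.+1) + size2 (H x y) == size2 (H x y.+1) + size2 (H x.+1 y) + 1).

Lemma fill_rule x y : la x y -> local_rule G H x y (fill x y).
Proof.
move=> l; have [_ _ _ /(_ l)[c lr]] := shrink_inv (cell_vertex l).
suff -> : fill x y = c by [].
case/and3P: lr => _ _ /eqP E; rewrite /fill l E /=.
by rewrite eqn_add2l; case: c {E}.
Qed.

Lemma fillC x y : fill x y = fill y x.
Proof.
rewrite /fill cellC; have [l|//] := boolP (la y x).
have V i j : i <= y.+1 -> j <= x.+1 -> vertex i j.
  by move=> *; apply: (@vertex_le y.+1 x.+1).
have E i j : i <= y.+1 -> j <= x.+1 -> H i j = H j i.
  by move=> lei lej; case: (shrink_inv (V i j lei lej)).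
by rewrite (E y.+1 x.+1) // (E y x) // (E y.+1 x) // (E y x.+1) // [size2 (H x.+1 y) + _]addnC.
Qed.

Lemma shrink_x0 x : H x 0 = (0, 0).
Proof.
have [m] := ubnP (n - x); elim: m x => // m IH x lem.
have v y : vertex y 0 by rewrite /vertex orbT.
have [l|nl] := boolP (la x 0).
  have [_ _ /(_ (v _)) [a] + _] := shrink_inv (v x).
  have ltx := cell_lt l; rewrite (IH x.+1 ltac:(lia)).
  case: (H x 0) => i j; rewrite /step; case: a; rewrite !xpair_eqE /= ?andbF //.
  by case/andP=> /eqP <- /eqP <-.
have [_ _ w0 _] := walk_w.
have -> : H x 0 = w x 0 by exact: shrink_out.
by apply: w0; rewrite /border v.
Qed.

Lemma column_size x y : vertex x.+1 y ->
  size2 (H x.+1 y) = size2 (H x y) + \sum_(j < y) fill x j.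
Proof.
elim: y => [|y IH] v; first by rewrite !shrink_x0 big_ord0.
have l : la x y by [].
rewrite big_ord_recr /=; have /and3P[_ _ /eqP E] := fill_rule l.
have := IH (vertex_le (leqnn _) (leqnSn _) v).
move: (\sum_(j < y) _) (size2 _) (size2 _) E => s i j.
by move: (size2 _) (size2 _) => i' j'; lia.
Qed.

(** By [column_size], the points of a column are counted by the size change along its top edge,
    which is prescribed by the walk. Thus a column has at most one point. *)
Lemma column_fill x : \sum_(j < height x) fill x j = inside x.
Proof.
have /andP[v nl] := border_height1 x; have /andP[v' nl'] := border_height x.
have := column_size v.
have -> : H x.+1 (height x) = w x.+1 (height x) by exact: shrink_out.
have -> : H x (height x) = w x (height x) by exact: shrink_out.
have [_ _ _ ws] := walk_w.
have := ws _ _ (border_height x) (border_height1 x).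
case: (w x _) (w x.+1 _) => [a b] [c d]; rewrite /step /size2 /=.
by case: (inside x); rewrite ?xpair_eqE /=; lia.
Qed.

Lemma fill_height x y : fill x y -> y < height x.
Proof. by case/andP=> + _; rewrite heightP. Qed.

Lemma fill_inside x y : fill x y -> inside x.
Proof.
move=> f; have := column_fill x; rewrite (bigD1 (Ordinal (fill_height f))) //= f.
by case: (inside x).
Qed.

Lemma fill_inj x y y' : fill x y -> fill x y' -> y = y'.
Proof.
move=> f f'; apply/eqP; apply: contraT => ne; have := column_fill x.
rewrite (bigD1 (Ordinal (fill_height f))) //= (bigD1 (Ordinal (fill_height f'))) /=.
  by rewrite f f'; case: (inside x).
by rewrite eq_sym.
Qed.

Lemma fill_ex x : inside x -> has (fill x) (iota 0 n).
Proof.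
move=> ix; apply: contraT => /hasPn nf; have := column_fill x; rewrite ix big1 // => j _.
have := ltn_ord j; rewrite -heightP => /cell_bound[_ ltn].
by rewrite (negPf (nf j _)) // mem_iota.
Qed.

(** The default [0] is never reached, by [fill_ex]. *)
Definition refill x := if inside x then nth 0 (iota 0 n) (find (fill x) (iota 0 n)) else p0 x.

Lemma fill_refill x : inside x -> fill x (refill x).
Proof. by move=> ix; rewrite /refill ix; apply/nth_find/fill_ex. Qed.

Lemma inside_p0 x : inside (p0 x) = inside x.
Proof. by rewrite /inside p0K cellC. Qed.

Lemma refill_placement : placement refill.
Proof.
split=> x.
- have [ix|nix] := boolP (inside x).
    have f := fill_refill ix; have f' : fill (refill x) x by rewrite fillC.
    exact: fill_inj (fill_refill (fill_inside f')) f'.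
  by rewrite {2}/refill (negPf nix) /refill inside_p0 (negPf nix) p0K.
- have [ix|nix] := boolP (inside x); first by case/andP: (fill_refill ix).
  by rewrite /refill (negPf nix); apply/negbTE.
- by move=> nix; rewrite /refill (negPf nix).
Qed.

Lemma refill_fill x y : la x y -> (refill x == y) = fill x y.
Proof.
move=> l; apply/eqP/idP=> [e|f]; last exact: fill_inj (fill_refill (fill_inside f)) f.
have [ix|nix] := boolP (inside x); first by rewrite -e; apply: fill_refill.
by move: l; rewrite -e /refill (negPf nix) => l; rewrite /inside l in nix.
Qed.

Lemma growth_refill x y : vertex x y -> growth G refill x y = H x y.
Proof.
have [rK _ _] := refill_placement.
have [m] := ubnP (x + y); elim: m x y => // m IH [|x] [|y] lem v;
  rewrite ?growth_x0 ?shrink_x0 //.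
  by case: (shrink_inv v) => _ -> _ _; rewrite shrink_x0.
have l : la x y by [].
have /and3P[_ /eqP -> _] := fill_rule l.
have V i j : i <= x.+1 -> j <= y.+1 -> vertex i j.
  by move=> *; apply: (@vertex_le x.+1 y.+1).
rewrite -(IH x y) -?(IH x y.+1) -?(IH x.+1 y) -?refill_fill //; try lia; exact: V.
Qed.

(** Surjectivity onto walks; with [growth_inj] it makes placements satisfying [growth_ok] correspond
    bijectively to walks, for either rule. *)
Lemma walk_placement :
  exists p, [/\ placement p, growth_ok G p & border_eq (growth G p) w].
Proof.
exists refill; split; first exact: refill_placement.
  move=> x y l; rewrite /local_rule refill_fill // !growth_refill //.
  - exact: fill_rule.
  - by apply: (@vertex_le x.+1 y.+1).
  - by apply: (@vertex_le x.+1 y.+1).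
  - exact: cell_vertex.
by move=> x y /andP[v nl]; rewrite growth_refill //; exact: shrink_out.
Qed.

End Backward.

End Growth.

(** * Local rules and the patterns 123 and 321 *)

Section Truncation.

Variables (n : nat) (la : sym_shape n) (m : nat).

(** Truncation at an anti-diagonal lets results about shapes satisfying [growth_ok] serve inside an
    induction that establishes [growth_ok]. *)
Definition trunc_cell x y := la x y && (x + y < m).

Lemma trunc_le x y x' y' : x' <= x -> y' <= y -> trunc_cell x y -> trunc_cell x' y'.
Proof. by move=> lex ley /andP[l ltm]; rewrite /trunc_cell (cell_le lex ley l); lia. Qed.

Lemma truncC x y : trunc_cell x y = trunc_cell y x.
Proof. by rewrite /trunc_cell cellC addnC. Qed.

Lemma trunc_lt x y : trunc_cell x y -> x < n.
Proof. by case/andP=> /cell_lt. Qed.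

Definition trunc := SymShape trunc_le truncC trunc_lt.

Lemma trunc_vertex x y : x + y < m.+2 -> vertex la x y -> vertex trunc x y.
Proof.
case: x y => [|x] [|y]; rewrite /vertex //= /trunc_cell => lem ->; lia.
Qed.

End Truncation.

(* A cell of anti-diagonal index m only sees the labels of the cells of smaller index. *)
Lemma growth_ok_ind n (la : sym_shape n) G p :
    (forall x y, la x y -> growth_ok (trunc la (x + y)) G p ->
       local_rule G (growth G p) x y (p x == y)) ->
  growth_ok la G p.
Proof.
move=> step_ok x y.
have [m] := ubnP (x + y); elim: m x y => // m IH x y lem l.
by apply: step_ok => // x' y' /andP[l' lt]; apply: IH l'; lia.
Qed.

Definition no123 n (la : sym_shape n) (p : nat -> nat) :=
  forall i j k, i < j -> j < k -> p i < p j -> p j < p k -> ~~ la k (p k).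

Definition no321 n (la : sym_shape n) (p : nat -> nat) :=
  forall i j k, i < j -> j < k -> p k < p j -> p j < p i -> ~~ la k (p i).

Definition step12 (w : nat -> nat -> label) x y : bool :=
  (w x.+1 y == ((w x y).1.+1, (w x y).2)) &&
  (w x.+2 y == ((w x y).1.+1, (w x y).2.+1)).

Section Local.

Variables (r m u : label) (a b : bool).
Hypotheses (vr : valid r) (vm : valid m) (vu : valid u).
Hypotheses (su : step a r u) (sm : step b r m).

(** The only obstruction is a point whose first-row box would open a third column. *)
Lemma col_local c : c ==> ~~ a && ~~ b -> c ==> (r.2 == 0) ->
  local_rel col_fwd col_bwd r m u (col_fwd r m u c) c.
Proof.
move: r m u a b vr vm vu su sm => [r1 r2] [m1 m2] [u1 u2] a' b'.
case E : (col_fwd _ _ _ c) => [l1 l2]; move: E.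
case: a'; case: b'; case: c => //; unfold_rules; move=> E ? ? ?;
  repeat (first [case/orP | move/eqP => [? ?]; subst]); move=> ? ?;
  move: E; case_ifs; case=> ? ?; subst; case_ifs; lia.
Qed.

(** The only obstruction is that both steps add a box to the second row, which would bump a box into
    a third row. *)
Lemma row_local c : c ==> ~~ a && ~~ b ->
    ~~ c ==> a ==> b ==> ~~ ((m.1 == r.1) && (u.1 == r.1)) ->
  local_rel row_fwd row_bwd r m u (row_fwd r m u c) c.
Proof.
move: r m u a b vr vm vu su sm => [r1 r2] [m1 m2] [u1 u2] a' b'.
case E : (row_fwd _ _ _ c) => [l1 l2]; move: E.
case: a'; case: b'; case: c => //; unfold_rules; move=> E ? ? ?;
  repeat (first [case/orP | move/eqP => [? ?]; subst]); move=> ? ?;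
  move: E; case_ifs; case=> ? ?; subst; case_ifs; lia.
Qed.

Lemma col_fwd_pos :
  (0 < (col_fwd r m u false).1) = (0 < m.1) || (0 < u.1) /\
  (0 < (col_fwd r m u false).2) = (0 < m.2) || (0 < u.2).
Proof.
move: r m u a b vr vm vu su sm => [r1 r2] [m1 m2] [u1 u2] a' b'.
case: a'; case: b'; unfold_rules; move=> ? ? ?;
  repeat (first [case/orP | move/eqP => [? ?]; subst]);
  case_ifs; lia.
Qed.

End Local.

Lemma row_local_neq r m u l : valid m -> valid r ->
    step true r u -> step true r m -> local_rel row_fwd row_bwd r m u l false ->
  ~~ ((m.1 == r.1) && (u.1 == r.1)).
Proof.
move: r m u l => [r1 r2] [m1 m2] [u1 u2] [l1 l2].
unfold_rules; move=> vm vr; repeat (first [case/orP | move/eqP => [? ?]; subst]);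
  case/and3P; case_ifs; lia.
Qed.

(** Carries the step pair up through two adjacent empty cells. The next two lemmas treat the row
    that contains the higher of the two points. *)
Lemma col_step12 a b c a' s : valid a -> valid b -> valid c -> valid a' ->
    step true a b -> step true b c -> step s a a' ->
  let b' := col_fwd a a' b false in let c' := col_fwd b b' c false in
  (b == (a.1.+1, a.2)) && (c == (a.1.+1, a.2.+1)) =
  (b' == (a'.1.+1, a'.2)) && (c' == (a'.1.+1, a'.2.+1)).
Proof.
move: a b c a' => [a1 a2] [b1 b2] [c1 c2] [d1 d2].
case: s; unfold_rules; move=> ? ? ? ?; repeat (first [case/orP | move/eqP => [? ?]; subst]);
  case_ifs; lia.
Qed.

Lemma col_step12_desc a c : valid a -> valid c -> step true a c ->
    let b' := col_fwd a a a true in local_rel col_fwd col_bwd a a a b' true ->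
  (b' == (a.1.+1, a.2)) && (col_fwd a b' c false == (a.1.+1, a.2.+1)) = false.
Proof.
move: a c => [a1 a2] [c1 c2]; rewrite {1}/valid {1}/valid {1}/step /=.
move=> va vc sc; cbv zeta.
case: (boolP (a1 == 0)) => z; case/orP: sc => /eqP[? ?]; subst c1 c2;
  case/and3P=> _ _; rewrite /col_fwd /size2 /=; case_ifs; lia.
Qed.

Lemma col_step12_asc a b : valid a -> valid b -> step true a b ->
    let c' := col_fwd b b b true in local_rel col_fwd col_bwd b b b c' true ->
  (b == (a.1.+1, a.2)) && (c' == (a.1.+1, a.2.+1)).
Proof.
move: a b => [a1 a2] [b1 b2].
unfold_rules; move=> va vb /orP[] /eqP[? ?]; subst;
  case/and3P=> _; case_ifs; lia.
Qed.

(** * Labels with two columns *)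

Section CellContext.

Variables (n : nat) (la : sym_shape n) (p : nat -> nat) (G : growth_rule).
Hypotheses (pK : involutive p) (okp : growth_ok la G p).

Lemma vertical_step x y : vertex la x y.+1 ->
  step (p y < x) (growth G p x y) (growth G p x y.+1).
Proof.
rewrite vertexC => v; have := growth_step pK okp v.
by rewrite !(growthC _ pK _ x).
Qed.

Lemma growthE x y : growth G p x.+1 y.+1 =
  fwd G (growth G p x y) (growth G p x y.+1) (growth G p x.+1 y) (p x == y).
Proof. by []. Qed.

Lemma point_excl x y : (p x == y) ==> ~~ (p x < y) && ~~ (p y < x).
Proof. by apply/implyP=> /eqP <-; rewrite pK !ltnn. Qed.

End CellContext.

Section Columns.

Variables (n : nat) (p : nat -> nat).
Hypothesis pK : involutive p.

Let g := growth col_rule p.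

(** The part of Schensted's theorem that is needed: the first row has at least one, resp. two, boxes
    iff there is an increasing sequence of that length. *)
Lemma col_pos (la : sym_shape n) x y : growth_ok la col_rule p -> vertex la x y ->
  (0 < (g x y).1 <-> exists2 i, i < x & p i < y) /\
  (0 < (g x y).2 <-> exists i j, [/\ i < j, j < x, p i < p j & p j < y]).
Proof.
move=> okp; have [m] := ubnP (x + y); elim: m x y => // m IH [|x] y lem v.
  by split; split=> // -[i]; [rewrite ltn0 | case=> j []].
case: y => [|y] in lem v *.
  by rewrite /g growth_x0; split; split=> // -[i]; [rewrite ltn0 | case=> j []].
have l : la x y by [].
have V i j : i <= x.+1 -> j <= y.+1 -> vertex la i j.
  by move=> *; apply: (@vertex_le _ _ x.+1 y.+1).
have [vm sm] : valid (g x y.+1) /\ step (p y < x) (g x y) (g x y.+1).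
  by split; [apply: growth_valid okp _ _ _ | apply: vertical_step okp _ _ _] => //; apply: V.
have [vu su] : valid (g x.+1 y) /\ step (p x < y) (g x y) (g x.+1 y).
  by split; [apply: growth_valid okp _ _ _ | apply: growth_step okp _ _ _] => //; apply: V.
have vr : valid (g x y) by apply: growth_valid okp _ _ _ => //; apply: V.
have [r1 r2] := IH x y ltac:(lia) (V _ _ (leqnSn _) (leqnSn _)).
have [m1 m2] := IH x y.+1 ltac:(lia) (V _ _ (leqnSn _) (leqnn _)).
have [u1 u2] := IH x.+1 y ltac:(lia) (V _ _ (leqnn _) (leqnSn _)).
rewrite /g growthE -/g /=; have [pxy|npxy] := eqVneq (p x) y.
  have -> : col_fwd (g x y) (g x y.+1) (g x.+1 y) true =
    if (g x y).1 == 0 then (1, 0) else ((g x y).1, 1) by [].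
  have -> : 0 < (if (g x y).1 == 0 then (1, 0) else ((g x y).1, 1)).1.
    by case: eqP => //=; case: (g x y).1.
  have -> : 0 < (if (g x y).1 == 0 then (1, 0) else ((g x y).1, 1)).2 = (0 < (g x y).1).
    by case: eqP => [->|] //=; case: (g x y).1.
  split; first by split=> // _; exists x; rewrite ?pxy.
  rewrite r1; split=> [[i lti ltpi]|[i [j [ltij ltj ltp ltpj]]]].
    by exists i, x; rewrite pxy; split.
  by exists i; lia.
have [-> ->] := col_fwd_pos vr vm vu su sm; split; split.
- by case/orP=> [/m1|/u1] [i lti ltpi]; exists i; lia.
- case=> i lti ltpi; apply/orP.
  have [ltix|leix] := ltnP i x; first by left; apply/m1; exists i.
  have eix : i = x by lia.
  by rewrite eix in ltpi; right; apply/u1; exists x => //; lia.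
- by case/orP=> [/m2|/u2] [i [j [ltij ltj ltp ltpj]]]; exists i, j; split; lia.
- case=> i [j [ltij ltj ltp ltpj]]; apply/orP.
  have [ltix|leix] := ltnP j x; first by left; apply/m2; exists i, j.
  have ejx : j = x by lia.
  by rewrite ejx in ltpj ltp ltij; right; apply/u2; exists i, x; split=> //; lia.
Qed.

(** At the last point of a 123 the label [r] already has a second column, so the point violates the
    size identity. *)
Lemma col_ok_no123 (la : sym_shape n) : growth_ok la col_rule p -> no123 la p.
Proof.
move=> okp i j k ltij ltjk pij pjk; apply/negP=> l.
have v : vertex la k.+1 (p k).+1 by [].
have V i' j' : i' <= k.+1 -> j' <= (p k).+1 -> vertex la i' j'.
  by move=> *; apply: vertex_le v.
have [_ [_ pos]] := col_pos okp (V _ _ (leqnSn _) (leqnSn _)).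
have {pos} : 0 < (g k (p k)).2 by apply: pos; exists i, j.
have := okp _ _ l; rewrite eqxx -/g.
have := vertical_step pK okp (V _ _ (leqnSn k) (leqnn _)); rewrite pK ltnn -/g.
have := growth_step pK okp (V _ _ (leqnn _) (leqnSn _)); rewrite ltnn -/g.
have := growth_valid pK okp (V _ _ (leqnSn k) (leqnSn (p k))).
rewrite /local_rule /= -/g.
move: (g k (p k)) (g k (p k).+1) (g k.+1 (p k)) (g k.+1 (p k).+1) => [r1 r2] mm uu ll.
rewrite /valid /= => vr /eqP -> /eqP ->; case: ll => [l1 l2]; rewrite /local_rel /col_fwd /size2 /=.
by case/and3P=> _; case_ifs; lia.
Qed.

Lemma no123_col_ok (la : sym_shape n) : no123 la p -> growth_ok la col_rule p.
Proof.
move=> av; apply: growth_ok_ind => x y l ok.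
have V i j : i <= x.+1 -> j <= y.+1 -> i + j < (x + y).+2 -> vertex (trunc la (x + y)) i j.
  move=> lei lej lt; apply: trunc_vertex => //.
  by apply: (@vertex_le _ _ x.+1 y.+1).
rewrite /local_rule growthE; apply: (col_local _ _ _ (growth_step pK ok _)
  (vertical_step pK ok _) (point_excl pK _ _)); try apply: growth_valid ok _ _ _ => //;
  try (apply: V; lia).
apply/implyP=> /eqP pxy; rewrite -leqn0 leqNgt; apply/negP.
have [_ [pos _]] := col_pos ok (V _ _ (leqnSn _) (leqnSn _) ltac:(lia)).
move/pos=> [i [j [ltij ltj ltp ltpj]]].
by have := av i j x ltij ltj ltp; rewrite pxy l => /(_ ltpj).
Qed.

(** Induction on [y], removing the top row: either it contains one of the two points, which settles
    the comparison, or [col_step12] applies. *)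
Lemma col_step12P (la : sym_shape n) x y : growth_ok la col_rule p ->
    vertex la x.+2 y -> p x < y -> p x.+1 < y ->
  step12 g x y = (p x < p x.+1).
Proof.
move=> okp; elim: y => // y IH v ltx lty.
have pneq : p x != p x.+1 by rewrite (inj_eq (inv_inj pK)) ltn_eqF.
have [l0 l1 l2] : [/\ x <= x.+2, x.+1 <= x.+2 & y <= y.+1] by split; lia.
have V i j : i <= x.+2 -> j <= y.+1 -> vertex la i j.
  by move=> *; apply: (@vertex_le _ _ x.+2 y.+1).
have vg i j : i <= x.+2 -> j <= y.+1 -> valid (g i j).
  by move=> lei lej; apply: growth_valid okp _ _ _ => //; apply: V.
have sa : step (p y < x) (g x y) (g x y.+1) by apply: vertical_step okp _ _ _ => //; apply: V.
have sb : step (p x < y) (g x y) (g x.+1 y) by apply: growth_step okp _ _ _ => //; apply: V.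
have sc : step (p x.+1 < y) (g x.+1 y) (g x.+2 y).
  by apply: growth_step okp _ _ _ => //; apply: V.
have va : valid (g x y) by exact: vg.
have vb : valid (g x.+1 y) by exact: vg.
have vc : valid (g x.+2 y) by exact: vg.
have va' : valid (g x y.+1) by exact: vg.
move: ltx lty; rewrite !ltnS [p x <= y]leq_eqVlt [p x.+1 <= y]leq_eqVlt.
case: eqVneq => [py _|npy /= ltx] /=; last case: eqVneq => [py1 _|npy1 /= lty] /=.
- rewrite -py eq_sym (negPf pneq) /= => px1; rewrite ltnNge (ltnW px1) /=.
  rewrite py in px1; have l : la x y by apply: (V x.+1 y.+1).
  have := okp _ _ l; rewrite py eqxx /local_rule -/g => lr.
  have e1 : g x.+1 y.+1 = col_fwd (g x y) (g x y.+1) (g x.+1 y) true.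
    by rewrite /g growthE py eqxx.
  have e2 : g x.+2 y.+1 = col_fwd (g x.+1 y) (g x.+1 y.+1) (g x.+2 y) false.
    by rewrite /g growthE ltn_eqF.
  rewrite e1 in lr; rewrite /step12 e2 e1.
  rewrite -{1}py pK ltnn in sa; rewrite py ltnn in sb; rewrite px1 in sc.
  rewrite (eqP sa) (eqP sb) in lr sc *.
  exact: col_step12_desc va vc sc lr.
- rewrite py1 ltx; have l : la x.+1 y by apply: (V x.+2 y.+1).
  have := okp _ _ l; rewrite py1 eqxx /local_rule -/g => lr.
  have e1 : g x.+1 y.+1 = col_fwd (g x y) (g x y.+1) (g x.+1 y) false.
    by rewrite /g growthE (negPf npy).
  have e2 : g x.+2 y.+1 = col_fwd (g x.+1 y) (g x.+1 y.+1) (g x.+2 y) true.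
    by rewrite /g growthE py1 eqxx.
  rewrite -{1}py1 pK ltnNge leqnSn in sa; rewrite ltx in sb; rewrite py1 ltnn in sc.
  have eb : g x.+1 y.+1 = g x.+1 y by rewrite e1 (eqP sa) /col_fwd eqxx.
  rewrite e2 eb (eqP sc) in lr; rewrite /step12 e2 eb (eqP sa) (eqP sc).
  exact: col_step12_asc va vb sb lr.
rewrite -IH //; last exact: V.
have e1 : g x.+1 y.+1 = col_fwd (g x y) (g x y.+1) (g x.+1 y) false.
  by rewrite /g growthE (negPf npy).
have e2 : g x.+2 y.+1 = col_fwd (g x.+1 y) (g x.+1 y.+1) (g x.+2 y) false.
  by rewrite /g growthE (negPf npy1).
rewrite ltx in sb; rewrite lty in sc.
by rewrite /step12 e2 e1 -(col_step12 va vb vc va' sb sc sa).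
Qed.

End Columns.

(** * Labels with two rows *)

Section Rows.

Variables (n : nat) (p : nat -> nat).
Hypothesis pK : involutive p.

Let g := growth row_rule p.

(* The first row of the label is the length of a longest increasing subsequence of the
   points in [0, x) x [0, y). *)
Definition lis x y := (g x y).1.

(** The first row obeys a recursion of its own, so the facts on [lis] hold at every vertex and can
    be used to prove [growth_ok]. *)
Lemma lisE x y : lis x.+1 y.+1 =
  if p x == y then (lis x y).+1 else maxn (lis x y.+1) (lis x.+1 y).
Proof. by []. Qed.

Lemma lisC x y : lis x y = lis y x.
Proof. by rewrite /lis /g growthC. Qed.

Lemma lis_x0 x : lis x 0 = 0.
Proof. by rewrite /lis /g growth_x0. Qed.


(** Monotonicity on row [y] gives that the point of that row has no effect up to its column; this in
    turn gives monotonicity on the next row. *)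
Lemma lis_row_skip_mono y :
  (forall x, lis x y <= lis x.+1 y) /\
  (forall x, x <= p y -> lis x y.+1 = lis x y).
Proof.
have skip z : (forall x, lis x z <= lis x.+1 z) ->
    forall x, x <= p z -> lis x z.+1 = lis x z.
  move=> mono; elim=> [|x IH] ltx; first by rewrite !(lisC 0) !lis_x0.
  rewrite lisE IH; last exact: ltnW.
  rewrite (inv_eqC pK); have -> : (p z == x) = false by lia.
  by apply/maxn_idPr.
elim: y => [|y [mono skipy]].
  by have mono0 x : lis x 0 <= lis x.+1 0 by [rewrite !lis_x0]; split=> //; apply: skip.
have mono1 x : lis x y.+1 <= lis x.+1 y.+1.
  rewrite lisE; have [pxy|_] := eqVneq; last exact: leq_maxl.
  by rewrite skipy // -pxy pK.
by split=> //; apply: skip.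
Qed.

Lemma lisS x y : lis x y <= lis x.+1 y.
Proof. by case: (lis_row_skip_mono y). Qed.

Lemma lis_mono x y x' y' : x <= x' -> y <= y' -> lis x y <= lis x' y'.
Proof.
have mono i j k : i <= k -> lis i j <= lis k j.
  by move/subnK <-; elim: (k - i) => //= d IH; apply: leq_trans IH (lisS _ _).
move=> lex ley; apply: (leq_trans (mono _ y _ lex)).
by rewrite (lisC x') (lisC x'); apply: mono.
Qed.

Lemma lis_col x y :
  lis x.+1 y = if p x < y then maxn (lis x y) (lis x (p x)).+1 else lis x y.
Proof.
elim: y => [|y IH]; first by rewrite !lis_x0.
have [_ skip] := lis_row_skip_mono y; have le := lis_mono (leqnn x) (leqnSn y).
rewrite lisE IH ltnS; case: (ltngtP (p x) y) => [lt|gt|eq] //=.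
- by rewrite maxnA (maxn_idPl le).
- exact/maxn_idPl.
- by rewrite skip -?eq ?pK // eq; apply/esym/maxn_idPr.
Qed.

Lemma lis_row x y :
  lis x y.+1 = if p y < x then maxn (lis x y) (lis (p y) y).+1 else lis x y.
Proof. by rewrite lisC lis_col (lisC y) (lisC y). Qed.

(** The rectangle [[a, x) x [b, y)] is empty, so the last point of an increasing sequence lies in
    one of the two remaining rectangles, and so does the whole sequence. *)
Lemma lis_corner a b x y : a <= x -> b <= y ->
    (forall i, a <= i -> i < x -> p i < y -> p i < b) ->
  lis x y = maxn (lis a y) (lis x b).
Proof.
move=> leax leby; elim: x leax => [|x IH] leax emp.
  by have -> : a = 0 by [lia]; rewrite !(lisC 0) !lis_x0.
have [eax|ltax] := eqVneq a x.+1.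
  by rewrite eax; apply/esym/maxn_idPl/lis_mono.
have lex : a <= x by lia.
rewrite !lis_col IH //; last by move=> i *; apply: emp; lia.
case: (ltnP (p x) y) => [lt|ge]; first by rewrite (emp x) //; lia.
by have -> : (p x < b) = false by lia.
Qed.

Lemma no321_row_ok (la : sym_shape n) : no321 la p -> growth_ok la row_rule p.
Proof.
move=> av; apply: growth_ok_ind => x y l ok.
have V i j : i <= x.+1 -> j <= y.+1 -> i + j < (x + y).+2 -> vertex (trunc la (x + y)) i j.
  move=> lei lej lt; apply: trunc_vertex => //.
  by apply: (@vertex_le _ _ x.+1 y.+1).
rewrite /local_rule growthE; apply: (row_local _ _ _ (growth_step pK ok _)
  (vertical_step pK ok _) (point_excl pK _ _)); try apply: growth_valid ok _ _ _ => //;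
  try (apply: V; lia).
apply/implyP=> npxy; apply/implyP=> ltx; apply/implyP=> lty.
rewrite -/(lis x y) -/(lis x y.+1) -/(lis x.+1 y) lis_col lis_row ltx lty.
(* A point in the corner rectangle would be the middle of a 321 with the points of row [y] and
   column [x]. Hence one of these two points extends a longest sequence, and the obstruction of
   [row_local] is absent. *)
rewrite (@lis_corner (p y) (p x) x y) //; try lia.
move=> i lei lti ltpi; rewrite ltnNge; apply/negP=> ge.
have ne1 : p i != p x by rewrite (inj_eq (inv_inj pK)); lia.
have ne2 : i != p y by apply/negP=> /eqP eiy; rewrite eiy pK ltnn in ltpi.
have := av (p y) i x ltac:(lia) lti ltac:(lia); rewrite pK l.
by move/(_ ltpi).
Qed.

(** Take a 321 with least [k + p i]. By minimality, sequences ending at the first or last point are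
    no longer than those ending at the middle one, so neither outer point raises [lis] at the cell
    [(k, p i)]: the case excluded by [row_local_neq]. *)
Lemma row_ok_no321 (la : sym_shape n) : growth_ok la row_rule p -> no321 la p.
Proof.
move=> okp i j k; have [m] := ubnP (k + p i); elim: m i j k => // m IH i j k lem.
move=> ltij ltjk pkj pji; apply/negP=> l.
have V i' j' : i' <= k.+1 -> j' <= (p i).+1 -> vertex la i' j'.
  by move=> *; apply: (@vertex_le _ _ k.+1 (p i).+1).
have npk : (p k == p i) = false by lia.
have := okp _ _ l; rewrite npk => lr.
have su : step true (g k (p i)) (g k.+1 (p i)).
  have := growth_step pK okp (V k.+1 (p i) (leqnn _) (leqnSn _)).
  by have -> : p k < p i by lia.
have sm : step true (g k (p i)) (g k (p i).+1).
  have := vertical_step pK okp (V k (p i).+1 (leqnSn _) (leqnn _)).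
  by rewrite pK; have -> : i < k by lia.
have := row_local_neq _ _ su sm lr; rewrite -/(lis _ _) -/(lis _ _) -/(lis _ _).
have vm := growth_valid pK okp (V k (p i).+1 (leqnSn _) (leqnn _)).
have vr := growth_valid pK okp (V k (p i) (leqnSn _) (leqnSn _)).
move/(_ vm vr)/negP; apply.
rewrite lis_col lis_row pK; have -> : p k < p i by lia. have -> : i < k by lia.
have big : (lis j (p j)).+1 <= lis k (p i).
  apply: leq_trans (@lis_mono j.+1 (p i) _ _ ltjk (leqnn _)).
  by rewrite lis_col pji leq_max leqnn orbT.
have lek : lis k (p k) <= lis j (p j).
  rewrite (@lis_corner j 0 k (p k)) //; [|lia|].
    by rewrite lis_x0 maxn0; apply: lis_mono => //; lia.
  move=> q lejq ltqk ltpq; exfalso.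
  have [eqj|neqj] := eqVneq q j; first by rewrite eqj in ltpq; lia.
  have := IH i j q ltac:(lia) ltij ltac:(lia) ltac:(lia) pji.
  by rewrite (cell_le _ _ l) //; lia.
have lei : lis i (p i) <= lis j (p j).
  rewrite (@lis_corner 0 (p j) i (p i)) //; [|lia|].
    by rewrite lisC lis_x0 max0n; apply: lis_mono => //; lia.
  move=> q _ ltqi ltpq; rewrite ltnNge; apply/negP=> ge.
  have neq : p q != p j by rewrite (inj_eq (inv_inj pK)); lia.
  have := IH q j k ltac:(lia) ltac:(lia) ltjk pkj ltac:(lia).
  by rewrite (cell_le _ _ l) //; lia.
by apply/andP; split; apply/eqP/maxn_idPl; lia.
Qed.

(** The pair means that column [x] raises [lis] and column [x.+1] does not. At a descent, avoidance
    leaves no earlier point above [p x] within the first [y] rows, so the point at [x] extends a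
    longest sequence; at an ascent, if [x] raises [lis], so does [x.+1]. *)
Lemma row_step12P (la : sym_shape n) x y : no321 la p ->
    vertex la x.+2 y -> p x < y -> p x.+1 < y ->
  step12 g x y = (p x.+1 < p x).
Proof.
move=> av v ltx lty; have okp := no321_row_ok av.
have v1 : vertex la x.+1 y by apply: vertex_le v.
have := growth_step pK okp v; have := growth_step pK okp v1.
rewrite ltx lty -/g => s1 s2.
have -> : step12 g x y = (lis x.+1 y == (lis x y).+1) && (lis x.+2 y == lis x.+1 y).
  move: s1 s2; rewrite /step12 /lis.
  case: (g x y) (g x.+1 y) (g x.+2 y) => [a1 a2] [b1 b2] [c1 c2].
  by rewrite /step !xpair_eqE /=; lia.
have neq : p x != p x.+1 by rewrite (inj_eq (inv_inj pK)); lia.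
have [asc|desc] := ltnP (p x) (p x.+1).
  have -> : (p x.+1 < p x) = false by lia.
  apply/negP=> /andP[/eqP e1 /eqP e2]; move: e2; rewrite (lis_col x.+1) lty (lis_col x (p _)) asc.
  by move: e1; rewrite lis_col ltx; lia.
have -> : p x.+1 < p x by lia.
have e : lis x y = lis x (p x).
  rewrite (@lis_corner 0 (p x) x y) //; first by rewrite lisC lis_x0 max0n.
    exact: ltnW.
  move=> q _ ltqx ltpq; rewrite ltnNge; apply/negP=> ge.
  have neq' : p q != p x by rewrite (inj_eq (inv_inj pK)); lia.
  have := av q x x.+1 ltqx (leqnn _) ltac:(lia) ltac:(lia).
  case: y ltpq v {ltx lty v1 s1 s2} => // y ltpq v.
  by rewrite (@cell_le _ la x.+1 y).
have le : lis x (p x.+1) <= lis x (p x) by apply: lis_mono => //; lia.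
rewrite (lis_col x.+1) lty (lis_col x) ltx (lis_col x (p _)) e.
have -> : (p x < p x.+1) = false by lia.
lia.
Qed.

End Rows.

(** * Moving the peaks along the border *)

Lemma leq_card_rel (T T' : finType) (A : {set T}) (B : {set T'}) (R : T -> T' -> Prop) :
    (forall a, a \in A -> exists2 b, b \in B & R a b) ->
    (forall a a' b, a \in A -> a' \in A -> R a b -> R a' b -> a = a') ->
  #|A| <= #|B|.
Proof.
have [m] := ubnP #|A|; elim: m A B => // m IH A B lem tot inj.
have [->|[a aA]] := set_0Vmem A; first by rewrite cards0.
have [b bB Rab] := tot a aA.
rewrite (cardsD1 a) (cardsD1 b B) aA bB ltnS; apply: IH.
- by move: lem; rewrite (cardsD1 a) aA; lia.
- move=> c /setD1P[nca cA]; have [d dB Rcd] := tot c cA.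
  exists d => //; apply/setD1P; split=> //; apply: contra nca => /eqP edb.
  by apply/eqP/(inj _ _ _ cA aA Rcd); rewrite edb.
- by move=> c c' d /setD1P[_ cA] /setD1P[_ cA']; apply: inj.
Qed.

(* A relation is used instead of a function because the properties P, P' are not decidable. *)
Definition embeds (P P' : (nat -> nat) -> Prop) :=
  exists R : (nat -> nat) -> (nat -> nat) -> Prop,
  (forall p, P p -> exists2 p', P' p' & R p p') /\
  (forall p q p' q', P p -> P q -> P' p' -> P' q' -> R p p' -> R q q' ->
     p' =1 q' -> p =1 q).

Lemma embeds_refl (P Q : (nat -> nat) -> Prop) : (forall p, P p -> Q p) -> embeds P Q.
Proof.
move=> PQ; exists (fun p p' => p =1 p').
split=> [p Pp|p q p' q' _ _ _ _ e1 e2 e x]; first by exists p => //; apply: PQ.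
by rewrite e1 e2.
Qed.

Lemma embeds_trans P Q S : embeds P Q -> embeds Q S -> embeds P S.
Proof.
move=> [R [R1 R2]] [R' [R1' R2']].
exists (fun p s => exists q, [/\ Q q, R p q & R' q s]); split=> [p Pp|].
  have [q Qq Rpq] := R1 p Pp; have [s Ss Rqs] := R1' q Qq.
  by exists s => //; exists q.
move=> p p' s s' Pp Pp' Ss Ss' [q [Qq Rpq Rqs]] [q' [Qq' Rpq' Rqs']] e.
exact: (R2 _ _ _ _ Pp Pp' Qq Qq' Rpq Rpq' (R2' _ _ _ _ Qq Qq' Ss Ss' Rqs Rqs' e)).
Qed.

Lemma eq_growth G p q : p =1 q -> growth G p =2 growth G q.
Proof.
move=> e; elim=> [|x IHx] y //; elim: y => [|y IHy]; first by rewrite !growth_x0.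
by rewrite !growthE IHy !IHx e.
Qed.

(* Knuth's elementary transformation on the labels of four consecutive border vertices:
   it exchanges the step sequences 112 and 121, and 212 and 122. *)
Definition flip (x0 x1 x2 x3 : label) : label * label :=
  if x3.1 == x0.1.+2 then (x1, (x1.1 + x3.1 - x2.1, x1.2 + x3.2 - x2.2))
  else ((x0.1 + x2.1 - x1.1, x0.2 + x2.2 - x1.2), x2).

Definition is12 (u v x : label) :=
  (v == (u.1.+1, u.2)) && (x == (u.1.+1, u.2.+1)).

(** The hypothesis leaves the words 112, 121, 212 and 122. Validity is at stake only for 122 to 212,
    where it follows from that of [x3]. *)
Lemma flip_spec x0 x1 x2 x3 (f := flip x0 x1 x2 x3) :
    valid x0 -> valid x1 -> valid x2 -> valid x3 ->
    step true x0 x1 -> step true x1 x2 -> step true x2 x3 ->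
    is12 x1 x2 x3 || is12 x0 x1 x2 ->
  [/\ [&& valid f.1, valid f.2, step true x0 f.1, step true f.1 f.2 & step true f.2 x3],
      is12 x1 x2 x3 -> is12 x0 f.1 f.2, is12 x0 x1 x2 -> is12 f.1 f.2 x3
    & flip x0 f.1 f.2 x3 = (x1, x2)].
Proof.
rewrite {}/f; move: x0 x1 x2 x3 => [a0 b0] [a1 b1] [a2 b2] [a3 b3].
rewrite /step /valid /is12 /= => ? ? ? ?.
repeat (case/orP=> /eqP[? ?]; subst); rewrite ?xpair_eqE /= => H12.
all: rewrite /flip /=; case_ifs; try (exfalso; lia).
all: split; rewrite ?xpair_eqE /=; try lia.
all: by case_ifs; congr ((_, _), (_, _)); lia.
Qed.

Section Peaks.

Variables (n : nat) (la : sym_shape n) (p0 : nat -> nat).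
Hypothesis p0K : involutive p0.

Let peak x := odd x && inside la p0 x.

Hypothesis peak_neighbours : forall x, peak x ->
  [/\ inside la p0 x.-1, inside la p0 x.+1, height la x.-1 = height la x
    & height la x.+1 = height la x].

Lemma peak_border x z : peak x -> x.-1 <= z <= x.+2 -> border la z (height la x).
Proof.
move=> pk /andP[lez gez]; have [_ _ h1 h2] := peak_neighbours pk.
have x0 : 0 < x by case/andP: pk; case: (x).
have [->|n1] := eqVneq z x.-1; first by rewrite -h1; apply: border_height.
have [->|n2] := eqVneq z x; first exact: border_height.
have [->|n3] := eqVneq z x.+1; first exact: border_height1.
have -> : z = x.+2 by lia.
by rewrite -h2; apply: border_height1.
Qed.

(* Interpolates between the peak condition for 321 (t = 0) and the one for 123 (t >= n). *)
Definition peak_steps t (w : nat -> nat -> label) := forall x, peak x ->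
  if x < t then step12 w x.-1 (height la x) else step12 w x (height la x).

Lemma peak_steps_eq t w w' : border_eq la w w' -> peak_steps t w -> peak_steps t w'.
Proof.
move=> e Q x pk; move: (Q x pk); have x0 : 0 < x by case/andP: pk; case: (x).
by case: ifP => _; rewrite /step12 !e //; apply: peak_border; lia.
Qed.

Section Theta.

Variable t : nat.
Hypothesis pk_t : peak t.

Let h := height la t.

Definition flip_at (w : nat -> nat -> label) := flip (w t.-1 h) (w t h) (w t.+1 h) (w t.+2 h).

(** The mirrored vertices are changed as well, to keep the labeling symmetric. *)
Definition theta w x y :=
  if (y == h) && (x == t) || (x == h) && (y == t) then (flip_at w).1
  else if (y == h) && (x == t.+1) || (x == h) && (y == t.+1) then (flip_at w).2
  else w x y.

Let t_gt0 : 0 < t.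
Proof. by case/andP: pk_t; case: (t). Qed.

Let h_gt0 : 0 < h.
Proof. by case/andP: pk_t => _; rewrite /inside heightP; apply: leq_trans. Qed.

(** Keeps the mirrored vertices out of row [h]. Otherwise the symmetry of the shape would contradict
    the equal heights of columns [t.-1], [t] and [t.+1]. *)
Let h_neq : (h != t) && (h != t.+1).
Proof.
have [_ _ h1 h2] := peak_neighbours pk_t.
apply/andP; split; apply/eqP=> e.
- have : la t.+1 t.-1 by rewrite heightP h2 -/h; lia.
  by rewrite cellC heightP h1 -/h; lia.
- have : la t.+1 t by rewrite heightP h2 -/h; lia.
  by rewrite cellC heightP -/h; lia.
Qed.

Lemma theta1 w : theta w t h = (flip_at w).1.
Proof. by rewrite /theta !eqxx. Qed.

Lemma theta2 w : theta w t.+1 h = (flip_at w).2.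
Proof.
rewrite /theta !eqxx /=; case: ifP => //; have := h_neq; lia.
Qed.

Lemma theta_row w z : z != t -> z != t.+1 -> theta w z h = w z h.
Proof.
move=> /negPf n1 /negPf n2; rewrite /theta n1 n2 !andbF /=.
by have /andP[/negPf-> /negPf->] := h_neq; rewrite !andbF.
Qed.

Lemma theta0 w : theta w t.-1 h = w t.-1 h.
Proof. by rewrite theta_row //; lia. Qed.

Lemma theta3 w : theta w t.+2 h = w t.+2 h.
Proof. by rewrite theta_row //; lia. Qed.

(** The mirrored vertices are interior to a vertical stretch of the border, so no horizontal border
    edge ends at one of them. *)
Lemma theta_off w x y : y != h -> border la x y -> border la x.+1 y ->
  theta w x y = w x y /\ theta w x.+1 y = w x.+1 y.
Proof.
move=> /negPf nyh /andP[_ b0] /andP[b1 _]; have [_ _ h1 h2] := peak_neighbours pk_t.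
have [eyt|nyt] := eqVneq y t.
  rewrite /theta nyh eyt /=.
  have nxh : (x == h) = false.
    apply/eqP=> exh; move: b1; rewrite /vertex exh eyt /=.
    have -> : (t == 0) = false by lia.
    by rewrite cellC heightP h1 ltnn.
  have nx1h : (x.+1 == h) = false.
    by apply/eqP=> exh; move: b0; rewrite eyt cellC heightP -/h -exh ltnSn.
  by rewrite nxh nx1h.
have [eyt1|nyt1] := eqVneq y t.+1.
  rewrite /theta nyh eyt1 /=.
  have nxh : (x == h) = false.
    by apply/eqP=> exh; move: b1; rewrite /vertex exh eyt1 /= cellC heightP ltnn.
  have nx1h : (x.+1 == h) = false.
    by apply/eqP=> exh; move: b0; rewrite eyt1 cellC heightP h2 -/h -exh ltnSn.
  by rewrite nxh nx1h.
by rewrite /theta nyh (negPf nyt) (negPf nyt1) !andbF.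
Qed.

Definition has12 (w : nat -> nat -> label) := step12 w t h || step12 w t.-1 h.

Lemma flip_at_spec w (f := flip_at w) : walk la p0 w -> has12 w ->
  [/\ [&& valid f.1, valid f.2, step true (w t.-1 h) f.1, step true f.1 f.2
        & step true f.2 (w t.+2 h)],
      step12 w t h -> is12 (w t.-1 h) f.1 f.2, step12 w t.-1 h -> is12 f.1 f.2 (w t.+2 h)
    & flip (w t.-1 h) f.1 f.2 (w t.+2 h) = (w t h, w t.+1 h)].
Proof.
move=> [_ wv _ ws] H12; have [i1 i2 h1 h2] := peak_neighbours pk_t.
have it : inside la p0 t by case/andP: pk_t.
have [b0 b1 b2 b3] : [/\ border la t.-1 h, border la t h, border la t.+1 h
    & border la t.+2 h] by split; apply: peak_border => //; lia.
have s0 : step true (w t.-1 h) (w t h).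
  by have := ws t.-1 h; rewrite prednK // i1; apply.
have s1 : step true (w t h) (w t.+1 h) by have := ws t h; rewrite it; apply.
have s2 : step true (w t.+1 h) (w t.+2 h) by have := ws t.+1 h; rewrite i2; apply.
move: H12; rewrite /has12 /step12 prednK // => H12.
by apply: flip_spec; rewrite // wv.
Qed.

Lemma theta_walk w : walk la p0 w -> has12 w -> walk la p0 (theta w).
Proof.
move=> ww H12; have [n0h n0t] : (0 == h) = false /\ (0 == t) = false by lia.
have [/and5P[v1 v2 s0 s1 s2] _ _ _] := flip_at_spec ww H12.
have [wC wv w0 ws] := ww; have [i1 i2 h1 h2] := peak_neighbours pk_t.
have it : inside la p0 t by case/andP: pk_t.
split.
- by move=> x y b; rewrite /theta (orbC (_ && (x == t))) (orbC (_ && (x == t.+1))) wC.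
- by move=> x y b; rewrite /theta; do 2 case: ifP => _ //; apply: wv.
- by move=> x b; rewrite /theta n0h n0t !andbF w0.
move=> x y b b'; have [eyh|nyh] := eqVneq y h; last first.
  by have [-> ->] := theta_off w nyh b b'; apply: ws.
rewrite eyh in b b' *; have [ext|next] := eqVneq x t.
  by rewrite ext theta1 theta2 it.
have [ext1|next1] := eqVneq x t.+1.
  by rewrite ext1 theta2 theta3 i2.
have [extp|nextp] := eqVneq x t.-1; first by rewrite extp prednK // theta1 theta0 i1.
by rewrite !theta_row ?ws // -[t]prednK // eqSS.
Qed.

Lemma theta_thetaK w : walk la p0 w -> has12 w -> border_eq la (theta (theta w)) w.
Proof.
move=> ww H12 x y b; have [_ _ _ fK] := flip_at_spec ww H12.
have e : flip_at (theta w) = (w t h, w t.+1 h).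
  rewrite /flip_at theta1 theta2 !theta_row //; lia.
have [wC _ _ _] := ww.
have B z : t.-1 <= z <= t.+2 -> border la z h by exact: peak_border.
rewrite /theta -/(theta w) e /=.
case: ifP => [/orP[] /andP[/eqP-> /eqP->] //|n1].
  by rewrite wC //; apply: B; lia.
case: ifP => [/orP[] /andP[/eqP-> /eqP->] //|n2].
  by rewrite wC //; apply: B; lia.
by rewrite /theta n1 n2.
Qed.

Lemma theta_eq w w' : border_eq la w w' -> border_eq la (theta w) (theta w').
Proof.
move=> e x y b.
have B z : t.-1 <= z <= t.+2 -> border la z h by exact: peak_border.
have -> : theta w x y = if (y == h) && (x == t) || (x == h) && (y == t) then (flip_at w).1
  else if (y == h) && (x == t.+1) || (x == h) && (y == t.+1) then (flip_at w).2 else w x y by [].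
by rewrite /theta /flip_at !e //; apply: B; lia.
Qed.

Lemma theta_step12 w x z : peak z -> z.-1 <= x -> x <= z -> x.+2 < t \/ t.+1 < x ->
  step12 (theta w) x (height la z) = step12 w x (height la z).
Proof.
move=> pk lez ltz far; rewrite /step12.
have [->|nh] := eqVneq (height la z) h.
  by rewrite !theta_row //; lia.
have [e1 e2] : theta w x (height la z) = w x (height la z) /\
    theta w x.+1 (height la z) = w x.+1 (height la z).
  by apply: theta_off => //; apply: peak_border => //; lia.
have [_ e3] : theta w x.+1 (height la z) = w x.+1 (height la z) /\
    theta w x.+2 (height la z) = w x.+2 (height la z).
  by apply: theta_off => //; apply: peak_border => //; lia.
by rewrite e1 e2 e3.
Qed.

(** Peaks are at odd positions. In row [h], the pairs already moved end at or before [t.-1] and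
    those not yet moved start at or after [t.+2], so the flip disturbs none of them. *)
Lemma theta_steps_right w : walk la p0 w -> peak_steps t w -> peak_steps t.+1 (theta w).
Proof.
move=> ww Q x pk; have Qt := Q t pk_t; rewrite ltnn -/h in Qt.
have H12 : has12 w by rewrite /has12 Qt.
have [_ /(_ Qt) i12 _ _] := flip_at_spec ww H12.
have [ext|next] := eqVneq x t.
  rewrite ext ltnSn /step12 prednK // theta1 theta2 theta_row //; lia.
have [ox ot] : odd x /\ odd t by case/andP: pk => -> _; case/andP: pk_t.
have x0 : 0 < x by case: (x) ox.
have := Q x pk; have -> : (x < t.+1) = (x < t) by lia.
by case: ltnP => ltx; rewrite theta_step12 //; lia.
Qed.

Lemma theta_steps_left w : walk la p0 w -> peak_steps t.+1 w -> peak_steps t (theta w).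
Proof.
move=> ww Q x pk; have Qt := Q t pk_t; rewrite ltnSn -/h in Qt.
have H12 : has12 w by rewrite /has12 Qt orbT.
have [_ _ /(_ Qt) i12 _] := flip_at_spec ww H12.
have [ext|next] := eqVneq x t.
  rewrite ext ltnn /step12 theta1 theta2 theta_row //; lia.
have [ox ot] : odd x /\ odd t by case/andP: pk => -> _; case/andP: pk_t.
have x0 : 0 < x by case: (x) ox.
have := Q x pk; have -> : (x < t.+1) = (x < t) by lia.
by case: ltnP => ltx; rewrite theta_step12 //; lia.
Qed.

End Theta.

(** * Transfer from border labels to placements *)

Definition grown G t p :=
  [/\ placement la p0 p, growth_ok la G p & peak_steps t (growth G p)].

(** Grow with [G], apply [F] on the border, and shrink with [G']. *)
Lemma embeds_walk G G' s s' (F : (nat -> nat -> label) -> nat -> nat -> label) :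
    (forall w, walk la p0 w -> peak_steps s w ->
       walk la p0 (F w) /\ peak_steps s' (F w)) ->
    (forall w w', walk la p0 w -> walk la p0 w' -> peak_steps s w -> peak_steps s w' ->
       border_eq la (F w) (F w') -> border_eq la w w') ->
  embeds (grown G s) (grown G' s').
Proof.
move=> FQ Finj; exists (fun p p' => border_eq la (growth G' p') (F (growth G p))).
split=> [p [pl ok Q]|].
  have [wF QF] := FQ _ (growth_walk pl ok) Q.
  have [p' [pl' ok' e]] := walk_placement p0K G' wF.
  exists p' => //; split=> //; apply: peak_steps_eq QF.
  by move=> x y b; rewrite e.
move=> p q p' q' [pl ok Q] [pl' ok' Q'] _ _ e e' epq.
apply: (growth_inj pl pl' ok ok').
apply: Finj => //; try exact: growth_walk.
by move=> x y b; rewrite -e // -e' // (eq_growth _ epq).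
Qed.

Lemma embeds_peak t : embeds (grown row_rule t) (grown row_rule t.+1) /\
  embeds (grown row_rule t.+1) (grown row_rule t).
Proof.
have [pk|npk] := boolP (peak t).
  split; apply: (@embeds_walk _ _ _ _ (theta t)).
  - move=> w ww Q; split; last exact: theta_steps_right.
    by apply: theta_walk => //; rewrite /has12; have := Q t pk; rewrite ltnn => ->.
  - move=> w w' ww ww' Q Q' e x y b.
    rewrite -(theta_thetaK pk ww) // -?(theta_thetaK pk ww') //.
    + exact: theta_eq.
    + by rewrite /has12; have := Q' t pk; rewrite ltnn => ->.
    + by rewrite /has12; have := Q t pk; rewrite ltnn => ->.
  - move=> w ww Q; split; last exact: theta_steps_left.
    by apply: theta_walk => //; rewrite /has12; have := Q t pk; rewrite ltnSn => ->; rewrite orbT.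
  - move=> w w' ww ww' Q Q' e x y b.
    rewrite -(theta_thetaK pk ww) // -?(theta_thetaK pk ww') //.
    + exact: theta_eq.
    + by rewrite /has12; have := Q' t pk; rewrite ltnSn => ->; rewrite orbT.
    + by rewrite /has12; have := Q t pk; rewrite ltnSn => ->; rewrite orbT.
have E w : peak_steps t w <-> peak_steps t.+1 w.
  split=> Q x pk; have := Q x pk; have net : x != t by apply: contraNneq npk => <-.
    by have -> : (x < t.+1) = (x < t) by lia.
  by have -> : (x < t.+1) = (x < t) by lia.
by split; apply: embeds_refl => p [pl ok Q]; split=> //; apply/E.
Qed.

Lemma embeds_peaks t : embeds (grown row_rule 0) (grown row_rule t) /\
  embeds (grown row_rule t) (grown row_rule 0).
Proof.
elim: t => [|t [e1 e2]]; first by split; apply: embeds_refl.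
have [e3 e4] := embeds_peak t.
by split; [apply: embeds_trans e1 e3 | apply: embeds_trans e4 e2].
Qed.

Definition peaks (p : nat -> nat) := forall x, peak x -> p x.-1 < p x /\ p x.+1 < p x.

Lemma placement_below p x : placement la p0 p -> inside la p0 x -> p x < height la x.
Proof. by case=> _ pin _ ix; rewrite -heightP pin. Qed.

Lemma row_peaks p : placement la p0 p ->
  (grown row_rule 0 p <-> no321 la p /\ peaks p).
Proof.
move=> pl; have [pK pin _] := pl.
have E x : no321 la p -> peak x ->
    step12 (growth row_rule p) x (height la x) = (p x.+1 < p x).
  move=> av pk; have [i1 i2 h1 h2] := peak_neighbours pk.
  have ix : inside la p0 x by case/andP: pk.
  apply: (row_step12P pK av); first by rewrite -h2; case/andP: (border_height1 la x.+1).
    exact: placement_below.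
  by rewrite -h2; apply: placement_below.
split=> [[_ ok Q]|[av pks]].
  have av := row_ok_no321 pK ok; split=> // x pk.
  have [i1 i2 h1 h2] := peak_neighbours pk.
  have d : p x.+1 < p x by rewrite -E //; have := Q x pk.
  split=> //; rewrite ltnNge leq_eqVlt; apply/negP=> /orP[/eqP|lt].
    by move/(inv_inj pK); case/andP: pk; case: (x) => // x' _ _; lia.
  have := av x.-1 x x.+1 ltac:(case/andP: pk; case: (x) => //) (leqnn _) d lt.
  rewrite heightP h2 -h1 => /negP; apply; exact: placement_below.
split=> //; first exact: no321_row_ok.
by move=> x pk /=; rewrite E //; case: (pks x pk).
Qed.

Lemma inside_lt x : inside la p0 x -> x < n.
Proof. exact: cell_lt. Qed.

(** With [t = n] every peak is tested by the pair starting at [x.-1], i.e. by the ascent before it;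
    the descent after it is forced, since an ascent would complete a 123 in the shape. *)
Lemma col_peaks p : placement la p0 p ->
  (grown col_rule n p <-> no123 la p /\ peaks p).
Proof.
move=> pl; have [pK pin _] := pl.
have E x : growth_ok la col_rule p -> peak x ->
    step12 (growth col_rule p) x.-1 (height la x) = (p x.-1 < p x).
  move=> ok pk; have [i1 i2 h1 h2] := peak_neighbours pk.
  have ix : inside la p0 x by case/andP: pk.
  have x0 : 0 < x by case/andP: pk; case: (x).
  rewrite -{4}(prednK x0); apply: (col_step12P pK ok); rewrite ?prednK //.
  - by case/andP: (border_height1 la x).
  - by rewrite -h1; apply: placement_below.
  - exact: placement_below.
have ltn x : peak x -> x < n by case/andP=> _; apply: inside_lt.
split=> [[_ ok Q]|[av pks]].
  have av := col_ok_no123 pK ok; split=> // x pk.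
  have [i1 i2 h1 h2] := peak_neighbours pk.
  have d : p x.-1 < p x by rewrite -E //; have := Q x pk; rewrite ltn.
  split=> //; rewrite ltnNge leq_eqVlt; apply/negP=> /orP[/eqP|lt].
    by move/(inv_inj pK); lia.
  have := av x.-1 x x.+1 ltac:(case/andP: pk; case: (x) => //) (leqnn _) d lt.
  by rewrite pin i2.
have ok := no123_col_ok pK av.
by split=> // x pk; rewrite ltn // E //; case: (pks x pk).
Qed.

Lemma embeds_321_123 :
  embeds (fun p => [/\ placement la p0 p, no321 la p & peaks p])
         (fun p => [/\ placement la p0 p, no123 la p & peaks p]) /\
  embeds (fun p => [/\ placement la p0 p, no123 la p & peaks p])
         (fun p => [/\ placement la p0 p, no321 la p & peaks p]).
Proof.
have [e1 e2] := embeds_peaks n.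
have row p : [/\ placement la p0 p, no321 la p & peaks p] <-> grown row_rule 0 p.
  split=> [[pl av pk]|g]; first exact/row_peaks.
  by have [pl _ _] := g; have [] := (row_peaks pl).1 g.
have col p : [/\ placement la p0 p, no123 la p & peaks p] <-> grown col_rule n p.
  split=> [[pl av pk]|g]; first exact/col_peaks.
  by have [pl _ _] := g; have [] := (col_peaks pl).1 g.
(* Row lengths are reread as column lengths: the same border labels are shrunk with the other
   rule. *)
have e3 G G' : embeds (grown G n) (grown G' n) by apply: (@embeds_walk _ _ _ _ id).
split.
  apply: embeds_trans (embeds_refl (fun p => (row p).1)) _.
  apply: embeds_trans (embeds_refl (fun p => (col p).2)).
  exact: embeds_trans e1 (e3 _ _).
apply: embeds_trans (embeds_refl (fun p => (col p).1)) _.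
apply: embeds_trans (embeds_refl (fun p => (row p).2)).
exact: embeds_trans (e3 _ _) e2.
Qed.

End Peaks.

(** * The dominated region *)

Definition nat_perm n (pi : 'S_n) (x : nat) : nat :=
  if insub x is Some i then val (pi i) else x.

Lemma nat_perm_ord n (pi : 'S_n) (i : 'I_n) : nat_perm pi i = pi i.
Proof. by rewrite /nat_perm valK. Qed.

Lemma nat_perm_out n (pi : 'S_n) x : n <= x -> nat_perm pi x = x.
Proof. by move=> lenx; rewrite /nat_perm insubF // ltnNge lenx. Qed.

Lemma nat_permP n (pi : 'S_n) (p : nat -> nat) :
  (forall x, n <= x -> p x = x) -> (forall i : 'I_n, p i = pi i) -> nat_perm pi =1 p.
Proof.
move=> out ins x; have [ltx|lex] := ltnP x n; last by rewrite nat_perm_out ?out.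
by rewrite -[x]/(val (Ordinal ltx)) nat_perm_ord ins.
Qed.

Lemma involution_permP n (pi : 'S_n) : reflect (involutive (nat_perm pi)) (pi == pi^-1)%g.
Proof.
apply: (iffP eqP) => [e x|inv].
  have [ltx|lex] := ltnP x n; last by rewrite !nat_perm_out ?nat_perm_out.
  by rewrite -[x]/(val (Ordinal ltx)) !nat_perm_ord {1}e permK.
apply/permP=> i; apply: (@perm_inj _ pi); rewrite permKV.
by apply: ord_inj; rewrite -!nat_perm_ord inv.
Qed.

Lemma involution_perm n (p : nat -> nat) : involutive p -> (forall x, n <= x -> p x = x) ->
  exists pi : 'S_n, nat_perm pi =1 p.
Proof.
move=> pK pout; have lt (i : 'I_n) : p i < n.
  by rewrite ltnNge; apply/negP=> le; have := ltn_ord i; rewrite -[nat_of_ord i]pK (pout _ le); lia.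
have inj : injective (fun i : 'I_n => Ordinal (lt i)).
  by move=> i j [] /(inv_inj pK) /val_inj.
by exists (perm inj); apply: nat_permP => // i; rewrite permE.
Qed.

Definition occurrence n k (pi : 'S_n) (sigma : 'S_k) (f : 'I_k -> 'I_n) :=
  (forall i j : 'I_k, i < j -> f i < f j) /\
  (forall i j : 'I_k, (pi (f i) < pi (f j)) = (sigma i < sigma j)).

Lemma containsP n k (pi : 'S_n) (sigma : 'S_k) :
  reflect (exists f, occurrence pi sigma f) (contains pi sigma).
Proof.
apply: (iffP existsP) => [[f]|[f [inc ord]]].
  by case/andP=> /'forall_'forall_implyP inc /'forall_'forall_eqP ord; exists f.
exists [ffun i => f i]; apply/andP; split.
  by apply/'forall_'forall_implyP=> i j; rewrite !ffunE; apply: inc.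
by apply/'forall_'forall_eqP=> i j; rewrite !ffunE.
Qed.

Lemma occurrence_lt n k (pi : 'S_n) (sigma : 'S_k) f :
  occurrence pi sigma f -> forall i j, (f i < f j) = (i < j).
Proof.
case=> inc _ i j; case: (ltngtP i j) => [/inc->|/inc lt|/val_inj->] //; last by rewrite ltnn.
by apply/negbTE; rewrite -leqNgt ltnW.
Qed.

Lemma occurrenceV n k (pi : 'S_n) (sigma : 'S_k) f : pi == pi^-1%g ->
  occurrence pi sigma f -> occurrence pi sigma^-1%g (fun i => pi (f (sigma^-1%g i))).
Proof.
move=> /eqP ipi oc; have [_ ord] := oc.
split=> i j; first by rewrite ord !permKV.
by rewrite {1 3}ipi !permK (occurrence_lt oc).
Qed.

Lemma containsV n k (pi : 'S_n) (sigma : 'S_k) : pi == pi^-1%g ->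
  contains pi sigma -> contains pi sigma^-1%g.
Proof.
move=> ipi /containsP[f oc]; apply/containsP.
by exists (fun i => pi (f (sigma^-1%g i))); apply: occurrenceV.
Qed.

Lemma dsum_lshift k m (a : 'S_k) (b : 'S_m) i : dsum a b (lshift m i) = lshift m (a i).
Proof.
rewrite permE /dsum_fun; case: split_ordP => j; last by move/eqP; rewrite eq_lrshift.
by move/lshift_inj->.
Qed.

Lemma dsum_rshift k m (a : 'S_k) (b : 'S_m) i : dsum a b (rshift k i) = rshift k (b i).
Proof.
rewrite permE /dsum_fun; case: split_ordP => j; first by move/eqP; rewrite eq_rlshift.
by move/rshift_inj->.
Qed.

Lemma dsumV k m (a : 'S_k) (b : 'S_m) : ((dsum a b)^-1 = dsum a^-1 b^-1)%g.
Proof.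
apply/permP=> x; apply: (@perm_inj _ (dsum a b)); rewrite permKV.
by case: (split_ordP x) => i ->; rewrite ?dsum_lshift ?dsum_rshift permKV.
Qed.

Lemma p321V : (p321^-1 = p321)%g.
Proof.
by apply/permP=> i; apply: (@perm_inj _ p321); rewrite permKV !permE rev_ordK.
Qed.

Lemma contains_dsum n k m (pi : 'S_n) (a : 'S_k) (b : 'S_m) :
  contains pi (dsum a b) <-> exists f g, [/\ occurrence pi a f, occurrence pi b g &
    forall i j, f i < g j /\ pi (f i) < pi (g j)].
Proof.
split=> [/containsP[h [inc ord]]|[f [g [[incf ordf] [incg ordg] fg]]]].
  exists (fun i => h (lshift m i)), (fun j => h (rshift k j)); split.
  - split=> i j; first by move=> lt; apply: inc.
    by rewrite ord !dsum_lshift.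
  - split=> i j; first by move=> lt; apply: inc; rewrite /= ltn_add2l.
    by rewrite ord !dsum_rshift /= ltn_add2l.
  - move=> i j; rewrite ord dsum_lshift dsum_rshift /=.
    split; last exact: ltn_addr.
    by apply: inc => /=; apply: ltn_addr.
apply/containsP; exists (fun x => match split x with inl i => f i | inr j => g j end).
have spl i : split (lshift m i) = inl i :> 'I_k + 'I_m by rewrite (unsplitK (inl i)).
have spr j : split (rshift k j) = inr j :> 'I_k + 'I_m by rewrite (unsplitK (inr j)).
split=> x y; case: (split_ordP x) => i ->; case: (split_ordP y) => j ->; rewrite ?spl ?spr.
- exact: incf.
- by move=> _; case: (fg i j).
- by move=> /= lt; have := ltn_ord j; lia.
- by rewrite /= ltn_add2l; apply: incg.
- by rewrite !dsum_lshift ordf.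
- rewrite dsum_lshift dsum_rshift /=; case: (fg i j) => _ ->.
  by apply/esym/ltn_addr.
- rewrite dsum_lshift dsum_rshift /=; case: (fg j i) => _ lt.
  by have := ltn_ord (a j); lia.
- by rewrite !dsum_rshift ordg /= ltn_add2l.
Qed.

Section Dominated.

Variables (n k : nat) (tau : 'S_k).
Hypothesis k_gt0 : 0 < k.

Definition above (pi : 'S_n) (sigma : 'S_k) (x y : nat) : bool :=
  [exists f : {ffun 'I_k -> 'I_n},
    [&& [forall i : 'I_k, forall j : 'I_k, (i < j) ==> (f i < f j)],
        [forall i : 'I_k, forall j : 'I_k, (pi (f i) < pi (f j)) == (sigma i < sigma j)]
      & [forall i : 'I_k, (x < f i) && (y < pi (f i))]]].

Lemma aboveP pi sigma x y :
  reflect (exists f, occurrence pi sigma f /\ forall i, x < f i /\ y < pi (f i))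
    (above pi sigma x y).
Proof.
apply: (iffP existsP) => [[f /and3P[/'forall_'forall_implyP inc /'forall_'forall_eqP ord]]|].
  by move/forallP=> ab; exists f; split=> // i; apply/andP.
case=> f [[inc ord] ab]; exists [ffun i => f i]; apply/and3P; split.
- by apply/'forall_'forall_implyP=> i j; rewrite !ffunE; apply: inc.
- by apply/'forall_'forall_eqP=> i j; rewrite !ffunE.
- by apply/forallP=> i; rewrite !ffunE; apply/andP.
Qed.

(* An involution contains 123 + tau or 321 + tau iff it contains the sum with tau^-1
   instead; taking both copies into account makes the region symmetric. *)
Definition dominated pi x y := above pi tau x y || above pi tau^-1%g x y.

Lemma dominatedP pi x y : reflect (exists2 sigma, (sigma == tau) || (sigma == tau^-1)%g &
  exists f, occurrence pi sigma f /\ forall i, x < f i /\ y < pi (f i)) (dominated pi x y).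
Proof.
apply: (iffP orP) => [[] /aboveP ex|[s /orP[] /eqP->] ex]; last 2 first.
- by left; apply/aboveP.
- by right; apply/aboveP.
- by exists tau; rewrite ?eqxx.
- by exists tau^-1%g; rewrite ?eqxx ?orbT.
Qed.

Lemma dominated_le pi x y x' y' : x' <= x -> y' <= y -> dominated pi x y -> dominated pi x' y'.
Proof.
move=> lex ley /dominatedP[s hs [f [oc ab]]]; apply/dominatedP; exists s => //; exists f.
by split=> // i; have [] := ab i; lia.
Qed.

Lemma dominated_lt pi x y : dominated pi x y -> x.+1 < n.
Proof.
case/dominatedP=> s _ [f [_ /(_ (Ordinal k_gt0)) [lt _]]].
exact: leq_ltn_trans lt (ltn_ord _).
Qed.

Lemma dominatedC pi x y : pi == pi^-1%g -> dominated pi x y = dominated pi y x.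
Proof.
move=> ipi; suff sub i j : dominated pi i j -> dominated pi j i by apply/idP/idP; apply: sub.
case/dominatedP=> s hs [f [oc ab]]; apply/dominatedP; exists s^-1%g.
  by case/orP: hs => /eqP->; rewrite ?invgK eqxx ?orbT.
exists (fun i => pi (f (s^-1%g i))); split; first exact: occurrenceV.
by move=> u; have [] := ab (s^-1%g u); rewrite {3}(eqP ipi) permK.
Qed.

Section Shape.

Variable pi0 : 'S_n.
Hypothesis pi0V : pi0 == pi0^-1%g.

Definition dominated_shape : sym_shape n :=
  @SymShape n (dominated pi0) (@dominated_le pi0) (fun x y => dominatedC x y pi0V)
    (fun x y d => ltnW (dominated_lt d)).

Let la := dominated_shape.
Let p0 := nat_perm pi0.

(** If the dominating copy is one of [tau^-1], inverting the whole occurrence in the involution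
    gives one of [tau], because [sigma] is its own inverse. *)
Lemma dominated_contains m (sigma : 'S_m) f x y : (sigma^-1 = sigma)%g ->
    occurrence pi0 sigma f -> dominated pi0 x y ->
    (forall i, f i <= x /\ pi0 (f i) <= y) ->
  contains pi0 (dsum sigma tau).
Proof.
move=> sV ocf /dominatedP[s hs [g [oc ab]]] lef.
have cs : contains pi0 (dsum sigma s).
  apply/contains_dsum; exists f, g; split=> // i u.
  by have [lex ley] := lef i; have [ltx lty] := ab u; lia.
case/orP: hs => /eqP es; first by rewrite -es.
by have := containsV pi0V cs; rewrite dsumV sV es invgK.
Qed.

Let o0 : 'I_3 := Ordinal (isT : 0 < 3).
Let o1 : 'I_3 := Ordinal (isT : 1 < 3).
Let o2 : 'I_3 := Ordinal (isT : 2 < 3).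

Let cell_triple i j l y : i < j -> j < l -> la l y ->
  exists f : 'I_3 -> 'I_n, [/\ f o0 = i :> nat, f o1 = j :> nat & f o2 = l :> nat].
Proof.
move=> ltij ltjl /cell_lt ltl; have ltj := ltn_trans ltjl ltl.
pose i' := Ordinal (ltn_trans ltij ltj).
by exists (fun x : 'I_3 => nth i' [:: i'; Ordinal ltj; Ordinal ltl] x).
Qed.

Let ord3P (P : 'I_3 -> Prop) : P o0 -> P o1 -> P o2 -> forall x, P x.
Proof.
by move=> P0 P1 P2 [[|[|[|//]]] lt]; [move: P0 | move: P1 | move: P2];
  congr P; apply: val_inj.
Qed.

Lemma avoids321 : avoids pi0 (dsum p321 tau) <-> no321 la p0.
Proof.
split=> [nc i j l ltij ltjl plj pji|av]; apply/negP.
  move=> d; have [f [e0 e1 e2]] := cell_triple ltij ltjl d.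
  rewrite -{}e0 -{}e1 -{}e2 /p0 !nat_perm_ord in ltij ltjl plj pji d.
  case/negP: nc; apply: (dominated_contains p321V (f := f) _ d); last by apply: ord3P; lia.
  by split; do 2 apply: ord3P; rewrite /p321 ?permE /=; lia.
case/contains_dsum=> f [g [[inc ord] oc fg]].
have := av (f o0) (f o1) (f o2); rewrite /p0 !nat_perm_ord !ord /p321 !permE /=.
move=> /(_ (inc o0 o1 isT) (inc o1 o2 isT) isT isT) /negP; apply.
apply/dominatedP; exists tau; rewrite ?eqxx //; exists g; split=> // u.
by case: (fg o2 u) (fg o0 u) => ? _ [].
Qed.

Lemma avoids123 : avoids pi0 (dsum p123 tau) <-> no123 la p0.
Proof.
split=> [nc i j l ltij ltjl pij pjl|av]; apply/negP.
  move=> d; have [f [e0 e1 e2]] := cell_triple ltij ltjl d.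
  rewrite -{}e0 -{}e1 -{}e2 /p0 !nat_perm_ord in ltij ltjl pij pjl d.
  case/negP: nc; apply: (dominated_contains (invg1 _) (f := f) _ d); last by apply: ord3P; lia.
  by split; do 2 apply: ord3P; rewrite ?perm1 /=; lia.
case/contains_dsum=> f [g [[inc ord] oc fg]].
have := av (f o0) (f o1) (f o2); rewrite /p0 !nat_perm_ord !ord !perm1 /=.
move=> /(_ (inc o0 o1 isT) (inc o1 o2 isT) isT isT) /negP; apply.
by apply/dominatedP; exists tau; rewrite ?eqxx //; exists g.
Qed.

End Shape.

End Dominated.

(** * Alternating involutions *)

Lemma alternatingP n (pi : 'S_n) :
  reflect (forall x, x.+1 < n -> if odd x then nat_perm pi x.+1 < nat_perm pi x
                                 else nat_perm pi x < nat_perm pi x.+1) (alternating pi).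
Proof.
apply: (iffP 'forall_'forall_implyP) => [alt x ltx|alt i j /eqP eji].
  have := alt (Ordinal (ltnW ltx)) (Ordinal ltx) (eqxx _).
  by rewrite -!nat_perm_ord.
have := alt i; rewrite -eji ltn_ord => /(_ isT).
by rewrite !nat_perm_ord.
Qed.

(** * Involutions with a common dominated region and common points outside it *)

Section Fibre.

Variables (n k : nat) (tau : 'S_k).
Hypothesis k_gt0 : 0 < k.

(** A dominating copy made of undominated points survives in [pi']. Otherwise one of its points is a
    dominated cell further up and to the right, to which induction applies. *)
Lemma dominated_sub (pi pi' : 'S_n) x y :
    (forall i : 'I_n, ~~ dominated tau pi i (pi i) -> pi' i = pi i) ->
  dominated tau pi x y -> dominated tau pi' x y.
Proof.
move=> eq_out; have [m] := ubnP (n - x + (n - y)); elim: m x y => // m IH x y lem d.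
have := d => /dominatedP[s hs [f [[inc ord] ab]]].
have [/forallP out|] := boolP [forall i, ~~ dominated tau pi (f i) (pi (f i))].
  apply/dominatedP; exists s => //; exists f; split; last by move=> i; rewrite eq_out.
  by split=> // i j; rewrite !eq_out.
rewrite negb_forall => /existsP[i]; rewrite negbK => di.
have [ltx lty] := ab i.
have lt : n - f i + (n - pi (f i)) < m.
  by have := ltn_ord (f i); have := ltn_ord (pi (f i)); lia.
exact: dominated_le (ltnW ltx) (ltnW lty) (IH _ _ lt di).
Qed.

Definition outside_key (pi : 'S_n) :=
  ([set c : 'I_n * 'I_n | dominated tau pi c.1 c.2],
   [ffun i : 'I_n => if dominated tau pi i (pi i) then None else Some (pi i)]).

Variable pi0 : 'S_n.
Hypothesis pi0V : pi0 == pi0^-1%g.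

Let la := dominated_shape tau k_gt0 pi0V.
Let p0 := nat_perm pi0.

Lemma key_dominated pi : pi == pi^-1%g -> outside_key pi = outside_key pi0 ->
  forall x y, dominated tau pi x y = dominated tau pi0 x y.
Proof.
move=> piV [/setP eD _] x y.
have [|nlt] := boolP ((x < n) && (y < n)).
  by case/andP=> ltx lty; have := eD (Ordinal ltx, Ordinal lty); rewrite !inE.
have F (p : 'S_n) : p == p^-1%g -> dominated tau p x y = false.
  move=> pV; apply: contraNF nlt => d; have ltx := dominated_lt k_gt0 d.
  by move: d; rewrite dominatedC // => /(dominated_lt k_gt0); lia.
by rewrite !F.
Qed.

Lemma key_placement pi : pi == pi^-1%g ->
  outside_key pi = outside_key pi0 <-> placement la p0 (nat_perm pi).
Proof.
move=> piV; split=> [e|[pK pin pout]].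
  have eD := key_dominated piV e; have [_ /ffunP eF] := e.
  have eI (i : 'I_n) : dominated tau pi0 i (pi i) = dominated tau pi0 i (pi0 i) /\
      (~~ dominated tau pi0 i (pi0 i) -> pi i = pi0 i).
    have := eF i; rewrite !ffunE eD.
    by do 2 case: ifP => //; move=> _ _ [].
  have big x p : n <= x -> (la x p = false).
    by move=> lex; apply/negP=> /cell_lt; rewrite ltnNge lex.
  split; first exact/involution_permP.
    move=> x; have [ltx|lex] := ltnP x n; last by rewrite /inside !big.
    by rewrite /inside -[x]/(val (Ordinal ltx)) /p0 !nat_perm_ord; case: (eI (Ordinal ltx)).
  move=> x; have [ltx|lex] := ltnP x n; last by rewrite /p0 !nat_perm_out.
  rewrite /inside -[x]/(val (Ordinal ltx)) /p0 !nat_perm_ord.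
  by case: (eI (Ordinal ltx)) => _ h /h ->.
have out (i : 'I_n) : ~~ dominated tau pi0 i (pi0 i) -> pi i = pi0 i.
  move=> nd; apply: ord_inj; rewrite -!nat_perm_ord; apply: pout.
  by rewrite /inside /p0 nat_perm_ord.
have ins (i : 'I_n) : dominated tau pi0 i (pi i) = dominated tau pi0 i (pi0 i).
  by have := pin i; rewrite /inside /p0 !nat_perm_ord.
have eD x y : dominated tau pi x y = dominated tau pi0 x y.
  have sub := @dominated_sub pi0 pi _ _ out.
  apply/idP/idP; last exact: sub.
  apply: dominated_sub => i nd; apply/esym/out; rewrite -ins.
  exact: contra (@sub _ _) nd.
congr (_, _); first by apply/setP=> c; rewrite !inE eD.
by apply/ffunP=> i; rewrite !ffunE eD ins; case: ifP => // /negbT/out->.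
Qed.

Hypothesis alt0 : alternating pi0.

(** A copy that dominates [(x, y)] but not [(x.+1, y)] must use the point of column [x.+1]. *)
Lemma dominated_height x y : la x y -> ~~ la x.+1 y -> y < p0 x.+1.
Proof.
move=> d nd; have ltx := dominated_lt k_gt0 d.
case/dominatedP: (d) => s hs [f [oc ab]].
have [/forallP far|] := boolP [forall i, x.+1 < f i].
  case/negP: nd; apply/dominatedP; exists s => //; exists f; split=> // i.
  by split; [apply: far | case: (ab i)].
rewrite negb_forall => /existsP[i]; rewrite -leqNgt => le.
have [ltxi lty] := ab i; have e : x.+1 = f i by lia.
by rewrite e /p0 nat_perm_ord.
Qed.

Lemma inside_height x : inside la p0 x.+1 -> height la x = height la x.+1.
Proof.
move=> i1; apply/eqP; rewrite eqn_leq andbC.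
have sub y : la x.+1 y -> la x y by apply: cell_le.
apply/andP; split; rewrite leqNgt; apply/negP=> lt.
  by have := sub (height la x); rewrite !heightP lt ltnn => /(_ isT).
have d : la x (height la x.+1) by rewrite heightP.
have nd : ~~ la x.+1 (height la x.+1) by rewrite heightP ltnn.
have := dominated_height d nd; move: i1; rewrite /inside heightP; lia.
Qed.

Lemma alt_step x : x.+1 < n -> if odd x then p0 x.+1 < p0 x else p0 x < p0 x.+1.
Proof. exact/alternatingP. Qed.

Lemma inside_before x : odd x.+1 -> inside la p0 x.+1 -> inside la p0 x.
Proof.
rewrite /inside => ox i1; have ltx : x.+1 < n by exact: cell_lt i1.
have ex : odd x = false by apply/negbTE.
have := alt_step ltx; rewrite ex => lt.
by apply: cell_le i1 => //; apply: ltnW.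
Qed.

(** The cell [(x, p0 x.+1)] lies below a dominated point; if [(x.+1, p0 x.+1)] were not dominated,
    [dominated_height] would put the point of column [x.+1] above itself. *)
Lemma inside_after x : odd x -> inside la p0 x -> inside la p0 x.+1.
Proof.
rewrite /inside => ox ix; have ltx := dominated_lt k_gt0 ix.
have := alt_step ltx; rewrite ox => lt; apply: contraT => nd.
have d : la x (p0 x.+1) by apply: cell_le ix => //; apply: ltnW.
by have := dominated_height d nd; rewrite ltnn.
Qed.

Lemma alternating_peaks x : odd x && inside la p0 x ->
  [/\ inside la p0 x.-1, inside la p0 x.+1, height la x.-1 = height la x
    & height la x.+1 = height la x].
Proof.
case/andP; case: x => // x ox ix; have ia := inside_after ox ix.
split=> //; first exact: inside_before ix.
- exact: inside_height.
- exact/esym/inside_height.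
Qed.

(** Two adjacent columns outside are unchanged, and two inside include a peak. At either end of a
    run, a wrong comparison would put the outside point, or a cell forbidden by [dominated_height],
    into the shape. *)
Lemma placement_alternating (pi : 'S_n) : placement la p0 (nat_perm pi) ->
  (alternating pi <-> peaks la p0 (nat_perm pi)).
Proof.
set p := nat_perm pi => pl; have [pK pin pout] := pl.
split=> [/alternatingP alt x /andP[ox ix]|pks].
  have ltx := dominated_lt k_gt0 ix.
  have x0 : 0 < x by case: (x) ox.
  split; last by have := alt x ltx; rewrite ox.
  have := alt x.-1; rewrite prednK //; have -> : odd x.-1 = false by lia.
  by apply; apply: ltnW.
apply/alternatingP=> x ltx; rewrite -/p; have := alt_step ltx.
have [ix|nix] := boolP (inside la p0 x); have [ix1|nix1] := boolP (inside la p0 x.+1).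
- case: ifP => ox _; first by have [] := pks x; rewrite /= ?ox.
  by have [] := pks x.+1; rewrite /= ?ox.
- have -> : odd x = false by apply: contraNF nix1 => ox; apply: inside_after.
  move=> _; rewrite (pout _ nix1) ltnNge; apply/negP=> le.
  have d : la x (p0 x.+1) by apply: (@cell_le _ la x (p x)); rewrite ?pin.
  by have := dominated_height d nix1; rewrite ltnn.
- have -> : odd x by apply: contraNT nix => ox; apply: inside_before.
  move=> _; rewrite (pout _ nix) ltnNge; apply/negP=> le.
  case/negP: nix; apply: (@cell_le _ la x.+1 (p x.+1)) => //.
  by rewrite pin.
- by rewrite (pout _ nix) (pout _ nix1).
Qed.

Lemma placement_eq p q : p =1 q -> placement la p0 p -> placement la p0 q.
Proof.
move=> e [pK pin pout]; split=> x; first by rewrite -!e.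
  by rewrite -e.
by move=> /pout; rewrite e.
Qed.

Lemma placement_perm p : placement la p0 p -> exists pi : 'S_n, nat_perm pi =1 p.
Proof.
case=> pK _ pout; apply: involution_perm => // x lex; rewrite pout /p0 ?nat_perm_out //.
by apply/negP=> /inside_lt; rewrite ltnNge lex.
Qed.

Definition fibre (sigma : 'S_3) : {set 'S_n} :=
  [set pi in AI n (dsum sigma tau) | outside_key pi == outside_key pi0].

(** Stated for abstract conditions so that it serves for both inequalities. *)
Lemma fibre_card_le (sigma sigma' : 'S_3) (P P' : (nat -> nat) -> Prop) :
    (forall p q, p =1 q -> P' p -> P' q) ->
    (forall pi : 'S_n, pi == pi^-1%g -> placement la p0 (nat_perm pi) ->
      (avoids pi (dsum sigma tau) <-> P (nat_perm pi)) /\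
      (avoids pi (dsum sigma' tau) <-> P' (nat_perm pi))) ->
    embeds (fun p => [/\ placement la p0 p, P p & peaks la p0 p])
           (fun p => [/\ placement la p0 p, P' p & peaks la p0 p]) ->
  #|fibre sigma| <= #|fibre sigma'|.
Proof.
move=> P'eq av [R [R1 R2]].
have to_P pi : pi \in fibre sigma ->
    [/\ placement la p0 (nat_perm pi), P (nat_perm pi) & peaks la p0 (nat_perm pi)].
  rewrite !inE => /andP[/and3P[alt piV avs] /eqP/(key_placement piV) pl].
  by split=> //; [apply/(av pi piV pl).1 | apply/(placement_alternating pl)].
apply: (@leq_card_rel _ _ _ _ (fun a b => exists p',
  [/\ placement la p0 p', P' p' & peaks la p0 p'] /\ R (nat_perm a) p' /\ p' =1 nat_perm b)).
  move=> a /to_P/R1[p' [pl' Pp' pks'] Rap']; have [b eb] := placement_perm pl'.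
  have eb' : p' =1 nat_perm b by move=> x; rewrite eb.
  exists b; last by exists p'.
  have plb := placement_eq eb' pl'.
  have bV : b == b^-1%g by apply/involution_permP; case: plb.
  rewrite !inE bV /=; apply/andP; split; last exact/eqP/key_placement.
  apply/andP; split; last by apply/(av b bV plb).2; apply: P'eq Pp'.
  by apply/(placement_alternating plb) => x /pks'; rewrite !eb'.
move=> a a' b /to_P Pa /to_P Pa' [p [Pp [Rp ep]]] [q [Pq [Rq eq]]].
have E := R2 _ _ _ _ Pa Pa' Pp Pq Rp Rq (fun x => etrans (ep x) (esym (eq x))).
by apply/permP=> i; apply: ord_inj; rewrite -!nat_perm_ord E.
Qed.

Lemma placement_avoids (pi : 'S_n) : pi == pi^-1%g -> placement la p0 (nat_perm pi) ->
  (avoids pi (dsum p321 tau) <-> no321 la (nat_perm pi)) /\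
  (avoids pi (dsum p123 tau) <-> no123 la (nat_perm pi)).
Proof.
move=> piV pl; have eD := key_dominated piV ((key_placement piV).2 pl).
split; split=> [av|av]; [|apply/(avoids321 tau k_gt0 piV)| |apply/(avoids123 tau k_gt0 piV)].
- move: av => /(avoids321 tau k_gt0 piV) av i j l; have := av i j l.
  by rewrite /= eD.
- by move=> i j l; rewrite /= eD; apply: av.
- move: av => /(avoids123 tau k_gt0 piV) av i j l; have := av i j l.
  by rewrite /= eD.
- by move=> i j l; rewrite /= eD; apply: av.
Qed.

Lemma fibre_card : #|fibre p123| = #|fibre p321|.
Proof.
have [e1 e2] := embeds_321_123 (involution_permP _ pi0V) alternating_peaks.
have eq123 p q : p =1 q -> no123 la p -> no123 la q.
  by move=> e av i j l; rewrite -!e; apply: av.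
have eq321 p q : p =1 q -> no321 la p -> no321 la q.
  by move=> e av i j l; rewrite -!e; apply: av.
apply/eqP; rewrite eqn_leq; apply/andP; split.
  by apply: fibre_card_le eq321 _ e2 => pi piV pl; have [] := placement_avoids piV pl.
by apply: fibre_card_le eq123 _ e1 => pi piV pl; apply: placement_avoids.
Qed.

End Fibre.

Theorem mainTheorem2 (n k : nat) (hn : 1 <= n) (hk : 1 <= k) (tau : 'S_k) :
  #|AI n (dsum p123 tau)| = #|AI n (dsum p321 tau)|.
Proof.
have split_fibres sigma : #|AI n (dsum sigma tau)| = \sum_key #|
    [set pi in AI n (dsum sigma tau) | outside_key tau pi == key]|.
  rewrite -sum1_card (partition_big (outside_key tau) predT) //=.
  by apply: eq_bigr => key _; rewrite -sum1_card; apply: eq_bigl => pi; rewrite inE.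
rewrite !split_fibres; apply: eq_bigr => key _.
have same (pi : 'S_n) sigma : pi \in AI n (dsum sigma tau) -> outside_key tau pi = key ->
    #|[set pi in AI n (dsum p123 tau) | outside_key tau pi == key]| =
    #|[set pi in AI n (dsum p321 tau) | outside_key tau pi == key]|.
  rewrite inE => /and3P[alt piV _] <-; exact: fibre_card.
set A := [set _ in _ | _]; set B := [set _ in _ | _].
(* A member of either fibre serves as the reference permutation; if there is none, both fibres are
   empty. *)
have [A0|[pi]] := set_0Vmem A; last by rewrite inE => /andP[piA /eqP]; apply: same piA.
have [->|[pi]] := set_0Vmem B; first by rewrite A0 !cards0.
by rewrite inE => /andP[piB /eqP]; apply: same piB.
Qed.
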